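(* (Decidable Learning Meta-Theorem.) Let $(\mathcal{L},\mathcal{M},\models)$ be a symbolic language with semantic domain $D$. Suppose there is a well-formed $\textsc{Facet}$ program $P$ over it (with computable signature functions) such that for all $M\in\mathcal{M}$ the set $\mathsf{Asp}(M)$ is finite, and for all $e\in\mathcal{L}$ and $d\in D$ there is a state $\sigma_d\in\mathsf{Asp}(M)$ for which $(M,\mathit{root}(e),\mathit{C}(P),\sigma_d)\Downarrow_p$ holds if and only if $M\models e=d$. Then $(\mathcal{L},\mathcal{M},\models)$ has decidable learning: given a finite set of examples $(M_i,d_i)_i\subseteq\mathcal{M}\times D$ and a regular tree grammar $\mathcal{G}$ over syntax trees of $\mathcal{L}$, one can decide whether there exists $e\in L(\mathcal{G})$ with $M_i\models e=d_i$ for all $i$, and if so compute such an $e$.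
   Context: A symbolic language $(\mathcal{L},\mathcal{M},\models)$ consists of a set of expressions $\mathcal{L}$ (identified with their syntax trees over a finite ranked alphabet $\Delta$), a class $\mathcal{M}$ of finitely representable structures, and a semantic function $\models:\mathcal{M}\times\mathcal{L}\to D$; $M\models e=d$ means the value is $d$. A regular tree grammar $\mathcal{G}=(\mathit{NT},\Delta,S,P)$ has productions $A\to t$ with $t$ a term over $\Delta$ and nonterminals; $L(\mathcal{G})$ is the set of ground terms derivable from $S$. A $\textsc{Facet}$ program $P$ is given by: a set $\mathsf{Asp}$ of auxiliary states with, for each structure $M$, a subset $\mathsf{Asp}(M)$ used on $M$; sets $S$ of state functions and $B$ of Boolean functions (closed under complement) on structures; and a finite set $\mathit{C}(P)$ of clauses of the form ''P($M$, $\sigma(z)$, $n$) = match $n.l$ with $\alpha_1(z)\to e_1\ \dots\ \alpha_m(z)\to e_m$'', with $\sigma(z)$ a state pattern, $n$ a pointer into a syntax tree, $n.l$ its label, $\alpha_i(z)$ alphabet patterns, and expressions $e ::= \texttt{True}\mid\texttt{False}\mid f(z)\mid e_1\ \texttt{and}\ e_2\mid e_1\ \texttt{or}\ e_2\mid \mathrm{P}(M,\sigma(z),n.\mathit{dir})\mid \texttt{all}(\lambda x.e)\,g(z)\mid \texttt{any}(\lambda x.e)\,g(z)\mid \texttt{if}\ f(z)\ \texttt{then}\ e_1\ \texttt{else}\ e_2$, with $f\in B$, $g\in S$ (returning a finite set), $\mathit{dir}\in\{\mathit{up},\mathit{stay},c_1,\dots,c_k\}$. Well-formed: for every $M$ and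 $\sigma\in\mathsf{Asp}(M)$ exactly one clause's state pattern matches $\sigma$, no free variables, and moves respect arities. Semantics: $(M,n,\mathit{C}(P),\sigma)\Downarrow_p$ holds iff for the unique clause matching $\sigma$ and the first case whose alphabet pattern matches $n.l$, the instantiated case expression $e$ satisfies $(M,n,\mathit{C}(P),e)\Downarrow_e$, where $\Downarrow_e$ is the least relation such that: True holds; $f(v)$ holds iff $f$ evaluates to true on $M$; and/or are conjunction/disjunction; the if-expression holds iff the branch selected by $f(v)$ holds; $\texttt{all}$ (resp. $\texttt{any}$) holds iff the body holds for every (resp. some) element of the finite set $g(v)$ computed on $M$; a call $\mathrm{P}(M,\sigma(v),n.\mathit{dir})$ holds iff $n.\mathit{dir}$ exists and $(M,n.\mathit{dir},\mathit{C}(P),\sigma')\Downarrow_p$ for the state $\sigma'$ denoted by $\sigma(v)$. $\mathit{root}(e)$ points to the root of $e$'s syntax tree.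
   Formalization: The state σ_d is chosen from M and d alone (not e), and the map (M,d) ↦ σ_d is assumed computable, without which the claim fails (e.g. M ⊨ e = d given by halting of M, with always-true/always-false states); Asp(M) is closed under the calls made from its states. *)

(* Defs.v *)
From Stdlib Require List.
From Stdlib Require Import Relation_Operators.
From HB Require Import structures.
From mathcomp Require Import all_boot.

Set Implicit Arguments.
Unset Strict Implicit.
Unset Printing Implicit Defensive.

(** * Data and computability

    All finite objects are coded as binary trees (S-expressions with a single
    atom).  "Computable" means computed by a program of the small first-order
    functional language [prog] below, i.e. it denotes the partial recursive
    functions on binary trees.  Computability is thus a genuine restriction: it
    is not a synonym for "definable by a Rocq term", and classical axioms do not
    make every function computable. *)

Inductive data : Type := Leaf | Pair of data & data.

Definition data_eq_dec (x y : data) : {x = y} + {x <> y}.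
Proof. by decide equality. Defined.

HB.instance Definition _ := hasDecEq.Build data (compareP data_eq_dec).

(** Programs are unary, strict, and tests regard [Leaf] as false.  [Self] calls
    the body of the innermost enclosing [Fix] (of the whole program if there is
    none). *)
Inductive prog : Type :=
| Id
| Nil
| Fst
| Snd
| Cons of prog & prog
| Comp of prog & prog
| Cond of prog & prog & prog
| Fix of prog
| Self.

(** [ev r p x y]: inside recursive body [r], program [p] maps [x] to [y]. *)
Inductive ev (r : prog) : prog -> data -> data -> Prop :=
| ev_id x : ev r Id x x
| ev_nil x : ev r Nil x Leaf
| ev_fst x y : ev r Fst (Pair x y) x
| ev_snd x y : ev r Snd (Pair x y) y
| ev_cons p q x y z : ev r p x y -> ev r q x z -> ev r (Cons p q) x (Pair y z)
| ev_comp p q x y z : ev r q x y -> ev r p y z -> ev r (Comp p q) x z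
| ev_cond_then c p q x u v y :
    ev r c x (Pair u v) -> ev r p x y -> ev r (Cond c p q) x y
| ev_cond_else c p q x y :
    ev r c x Leaf -> ev r q x y -> ev r (Cond c p q) x y
| ev_fix p x y : ev p p x y -> ev r (Fix p) x y
| ev_self x y : ev r r x y -> ev r Self x y.

Definition eval (p : prog) : data -> data -> Prop := ev p p.

Lemma ev_det r p x y z : ev r p x y -> ev r p x z -> y = z.
Proof.
move=> E; elim: E z => {r p x y};
  try by [move=> r x z E; inversion E | move=> r x y z E; inversion E].
- move=> r p q x y z _ IH1 _ IH2 w E; inversion E; subst.
  by congr Pair; [apply: IH1 | apply: IH2].
- move=> r p q x y z _ IH1 _ IH2 w E.
  inversion E as [| | | | |? ? ? v ? Ev Ew| | | |].
  by apply: IH2; rewrite (IH1 _ Ev).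
- move=> r c p q x u v y _ IH1 _ IH2 w E.
  inversion E as [| | | | | | |? ? ? ? ? Ec| |]; first exact: IH2.
  by have := IH1 _ Ec.
- move=> r c p q x y _ IH1 _ IH2 w E.
  inversion E as [| | | | | |? ? ? ? ? ? ? Ec| | |]; last exact: IH2.
  by have := IH1 _ Ec.
- by move=> r p x y _ IH z E; inversion E; apply: IH.
- by move=> r x y _ IH z E; inversion E; apply: IH.
Qed.

Class encoding (T : Type) : Type := Encoding {
  enc : T -> data;
  enc_inj : injective enc }.

(** [f] is computable with respect to the given encodings. *)
Definition computable {A B : Type} {eA : encoding A} {eB : encoding B}
    (f : A -> B) : Prop :=
  exists p : prog, forall x : A, eval p (enc x) (enc (f x)).

(** ** Standard encodings *)

#[export] Instance enc_data : encoding data := Encoding (@inj_id data).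

Definition bool_code (b : bool) : data := if b then Pair Leaf Leaf else Leaf.
Lemma bool_code_inj : injective bool_code.
Proof. by case=> [] []. Qed.
#[export] Instance enc_bool : encoding bool := Encoding bool_code_inj.

Definition nat_code (n : nat) : data := iter n (Pair Leaf) Leaf.
Lemma nat_code_inj : injective nat_code.
Proof. by elim=> [|n IHn] [|m] //= [/IHn->]. Qed.
#[export] Instance enc_nat : encoding nat := Encoding nat_code_inj.

Definition prod_code {A B} {eA : encoding A} {eB : encoding B} (x : A * B) : data :=
  Pair (enc x.1) (enc x.2).
Lemma prod_code_inj A B (eA : encoding A) (eB : encoding B) :
  injective (@prod_code A B eA eB).
Proof. by move=> [x y] [x' y'] [] /= /(@enc_inj _ eA)-> /(@enc_inj _ eB)->. Qed.
#[export] Instance enc_prod {A B} {eA : encoding A} {eB : encoding B} :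
  encoding (A * B) := Encoding (@prod_code_inj A B eA eB).

Definition option_code {A} {eA : encoding A} (x : option A) : data :=
  if x is Some a then Pair Leaf (enc a) else Leaf.
Lemma option_code_inj A (eA : encoding A) : injective (@option_code A eA).
Proof. by move=> [x|] [y|] //= [/(@enc_inj _ eA)->]. Qed.
#[export] Instance enc_option {A} {eA : encoding A} :
  encoding (option A) := Encoding (@option_code_inj A eA).

Definition list_code : seq data -> data := foldr Pair Leaf.
Lemma list_code_inj : injective list_code.
Proof. by elim=> [|x s IHs] [|y t] //= [-> /IHs->]. Qed.

Definition seq_code {A} {eA : encoding A} (s : seq A) : data :=
  list_code (map enc s).
Lemma seq_code_inj A (eA : encoding A) : injective (@seq_code A eA).
Proof. by move=> s t /list_code_inj /(inj_map enc_inj). Qed.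
#[export] Instance enc_seq {A} {eA : encoding A} :
  encoding (seq A) := Encoding (@seq_code_inj A eA).

(** * Syntax trees and regular tree grammars *)

Inductive tree (X : Type) : Type := Node of X & seq (tree X).

(** Terms over the alphabet [X] and nonterminals, the latter named by naturals. *)
Inductive gterm (X : Type) : Type :=
| NT of nat
| GNode of X & seq (gterm X).
Arguments NT {X}.

Fixpoint ranked {X : Type} (ar : X -> nat) (t : tree X) : bool :=
  let: Node a ts := t in (size ts == ar a) && all (ranked ar) ts.

Fixpoint branked {X : Type} (ar : X -> nat) (nts : seq nat) (t : gterm X) : bool :=
  match t with
  | NT A => A \in nts
  | GNode a ts => (size ts == ar a) && all (branked ar nts) ts
  end.

Fixpoint ground {X : Type} (t : tree X) : gterm X :=
  let: Node a ts := t in GNode a (map ground ts).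

Record grammar (X : Type) : Type := Grammar {
  nonterminals : seq nat;
  start : nat;
  productions : seq (nat * gterm X) }.

Definition wf_grammar {X : Type} (ar : X -> nat) (G : grammar X) : Prop :=
  start G \in nonterminals G /\
  forall A t, List.In (A, t) (productions G) ->
    A \in nonterminals G /\ branked ar (nonterminals G) t.

Inductive step {X : Type} (G : grammar X) : gterm X -> gterm X -> Prop :=
| step_here A t : List.In (A, t) (productions G) -> step G (NT A) t
| step_in a l t t' r :
    step G t t' -> step G (GNode a (l ++ t :: r)) (GNode a (l ++ t' :: r)).

Definition generates {X : Type} (G : grammar X) (e : tree X) : Prop :=
  clos_refl_trans (gterm X) (step G) (NT (start G)) (ground e).

(** ** Their encodings *)

Fixpoint tree_code {X} {eX : encoding X} (t : tree X) : data :=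
  let: Node a ts := t in Pair (enc a) (list_code (map tree_code ts)).

Lemma tree_code_inj X (eX : encoding X) : injective (@tree_code X eX).
Proof.
rewrite /injective; fix IH 1 => -[a ts] [b us] /= [/(@enc_inj _ eX)-> /list_code_inj H].
congr Node; elim: ts us H => [|t ts IHs] [|u us] //= [/IH-> /IHs->] //.
Qed.
#[export] Instance enc_tree {X} {eX : encoding X} :
  encoding (tree X) := Encoding (@tree_code_inj X eX).

Fixpoint gterm_code {X} {eX : encoding X} (t : gterm X) : data :=
  match t with
  | NT A => Pair Leaf (enc A)
  | GNode a ts =>
      Pair (Pair Leaf Leaf) (Pair (enc a) (list_code (map gterm_code ts)))
  end.

Lemma gterm_code_inj X (eX : encoding X) : injective (@gterm_code X eX).
Proof.
rewrite /injective; fix IH 1 => -[A|a ts] [B|b us] //=; first by case=> /nat_code_inj ->.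
move=> [/(@enc_inj _ eX)-> /list_code_inj H].
congr GNode; elim: ts us H => [|t ts IHs] [|u us] //= [/IH-> /IHs->] //.
Qed.
#[export] Instance enc_gterm {X} {eX : encoding X} :
  encoding (gterm X) := Encoding (@gterm_code_inj X eX).

Definition grammar_code {X} {eX : encoding X} (G : grammar X) : data :=
  enc (nonterminals G, start G, productions G).
Lemma grammar_code_inj X (eX : encoding X) : injective (@grammar_code X eX).
Proof. move=> [n s p] [n' s' p'] E.
by have [-> -> ->] := enc_inj (E : enc (n, s, p) = enc (n', s', p')). Qed.
#[export] Instance enc_grammar {X} {eX : encoding X} :
  encoding (grammar X) := Encoding (@grammar_code_inj X eX).

(** * Symbolic languages *)

(** The encodings express that structures, semantic values and symbols are
    finitely representable. *)
Record sym_lang : Type := SymLang {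
  alphabet : finType;
  arity : alphabet -> nat;
  alphabet_enc : encoding alphabet;
  structure : Type;
  structure_enc : encoding structure;
  domain : Type;
  domain_enc : encoding domain;
  lang : pred (tree alphabet);
  lang_ranked : forall e, lang e -> ranked arity e;
  sem : structure -> {e : tree alphabet | lang e} -> domain }.

#[export] Existing Instance alphabet_enc.
#[export] Existing Instance structure_enc.
#[export] Existing Instance domain_enc.

Definition expr (L : sym_lang) : Type := {e : tree (alphabet L) | lang e}.

Definition expr_code {L : sym_lang} (e : expr L) : data := enc (sval e).
Lemma expr_code_inj (L : sym_lang) : injective (@expr_code L).
Proof. move=> e e' E.
exact: val_inj (enc_inj (E : enc (sval e) = enc (sval e'))). Qed.
#[export] Instance enc_expr {L : sym_lang} : encoding (expr L) :=
  Encoding (@expr_code_inj L).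

Definition solves {L : sym_lang} (exs : seq (structure L * domain L))
    (G : grammar (alphabet L)) (e : expr L) : Prop :=
  generates G (sval e) /\ forall M d, List.In (M, d) exs -> sem M e = d.

(** One program must work uniformly for all examples and all grammars generating
    expressions of the language. *)
Definition decidable_learning (L : sym_lang) : Prop :=
  exists p : prog,
    forall (exs : seq (structure L * domain L)) (G : grammar (alphabet L)),
      wf_grammar (@arity L) G ->
      (forall t, generates G t -> lang t) ->
      exists r : option (expr L),
        eval p (enc (exs, G)) (enc r) /\
        match r with
        | Some e => solves exs G e
        | None => ~ exists e : expr L, solves exs G e
        end.

(** * Facet programs *)

(** Variables are naturals and range over data.  A pattern is a first-order term
    over data: read as a state expression it denotes the instance obtained from
    an environment, read as a pattern it matches exactly its instances. *)
Inductive pat : Type :=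
| PVar of nat
| PLeaf
| PPair of pat & pat.

Definition env : Type := seq (nat * data).

Fixpoint find_var (rho : env) (x : nat) : option data :=
  if rho is (y, v) :: rho' then if x == y then Some v else find_var rho' x
  else None.

Definition value (rho : env) (x : nat) : data := odflt Leaf (find_var rho x).

Fixpoint inst (rho : env) (p : pat) : data :=
  match p with
  | PVar x => value rho x
  | PLeaf => Leaf
  | PPair p q => Pair (inst rho p) (inst rho q)
  end.

Fixpoint pat_vars (p : pat) : seq nat :=
  match p with
  | PVar x => [:: x]
  | PLeaf => [::]
  | PPair p q => pat_vars p ++ pat_vars q
  end.

(** Extends [rho] so that [p] instantiates to [v]; variables that are already
    bound must agree. *)
Fixpoint pmatch (p : pat) (v : data) (rho : env) : option env :=
  match p, v with
  | PVar x, _ =>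
      match find_var rho x with
      | None => Some ((x, v) :: rho)
      | Some w => if w == v then Some rho else None
      end
  | PLeaf, Leaf => Some rho
  | PPair p q, Pair u w => obind (pmatch q w) (pmatch p u rho)
  | _, _ => None
  end.

Inductive dir : Type := Up | Stay | Child of nat.

(** [B] and [S] are the names of the Boolean functions and state functions. *)
Inductive fexpr (B S : Type) : Type :=
| ETrue
| EFalse
| ETest of B & seq nat
| EAnd of fexpr B S & fexpr B S
| EOr of fexpr B S & fexpr B S
| ECall of pat & dir
| EAll (x : nat) (body : fexpr B S) (g : S) (zs : seq nat)
| EAny (x : nat) (body : fexpr B S) (g : S) (zs : seq nat)
| EIf (f : B) (zs : seq nat) (e1 e2 : fexpr B S).

Record clause (B S : Type) : Type := Clause {
  state_pat : pat;
  cases : seq (pat * fexpr B S) }.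

(** A finite set returned by a state function is given by an enumeration. *)
Record facet (L : sym_lang) : Type := Facet {
  bsym : Type;
  ssym : Type;
  bfun : bsym -> structure L -> seq data -> bool;
  bfun_compl : forall f, exists f', forall M vs, bfun f' M vs = ~~ bfun f M vs;
  sfun : ssym -> structure L -> seq data -> seq data;
  asp : structure L -> data -> Prop;
  clauses : seq (clause bsym ssym) }.

Definition fbody {L : sym_lang} (P : facet L) : Type := fexpr (bsym P) (ssym P).

Definition state_matches {B S : Type} (s : data) (c : clause B S) : bool :=
  isSome (pmatch (state_pat c) s [::]).

Fixpoint first_case {B S : Type} (cs : seq (pat * fexpr B S)) (a : data)
    (rho : env) : option (env * fexpr B S) :=
  if cs is (p, e) :: cs' then
    if pmatch p a rho is Some rho' then Some (rho', e) else first_case cs' a rho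
  else None.

(** The case expression, and its variable binding, that the program selects in
    state [s] at a node labelled [a]. *)
Definition select {L : sym_lang} (P : facet L) (s : data) (a : alphabet L) :
    option (env * fbody P) :=
  if [seq c <- clauses P | state_matches s c] is [:: c] then
    obind (first_case (cases c) (enc a)) (pmatch (state_pat c) s [::])
  else None.

(** ** Semantics *)

(** A pointer is the path from the root, as a sequence of child indices. *)
Fixpoint subtree {X : Type} (t : tree X) (n : seq nat) : option (tree X) :=
  if n is i :: n' then
    let: Node _ ts := t in obind (fun t' => subtree t' n') (onth ts i)
  else Some t.

Definition label {X : Type} (t : tree X) : X := let: Node a _ := t in a.

Definition move {X : Type} (t : tree X) (n : seq nat) (d : dir) :
    option (seq nat) :=
  match d with
  | Stay => Some n
  | Up => if n is i :: n' then Some (belast i n') else None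
  | Child i => if subtree t (rcons n i) is Some _ then Some (rcons n i) else None
  end.

Inductive run_state {L : sym_lang} (P : facet L) (M : structure L)
    (t : tree (alphabet L)) : seq nat -> data -> Prop :=
| run_select n s u rho e :
    subtree t n = Some u -> select P s (label u) = Some (rho, e) ->
    run_expr M t n rho e -> run_state P M t n s
with run_expr {L : sym_lang} {P : facet L} (M : structure L)
    (t : tree (alphabet L)) : seq nat -> env -> fbody P -> Prop :=
| run_true n rho : run_expr M t n rho (ETrue _ _)
| run_test n rho f zs :
    bfun f M (map (value rho) zs) -> run_expr M t n rho (ETest _ f zs)
| run_and n rho e1 e2 :
    run_expr M t n rho e1 -> run_expr M t n rho e2 ->
    run_expr M t n rho (EAnd e1 e2)
| run_or_l n rho e1 e2 :
    run_expr M t n rho e1 -> run_expr M t n rho (EOr e1 e2)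
| run_or_r n rho e1 e2 :
    run_expr M t n rho e2 -> run_expr M t n rho (EOr e1 e2)
| run_call n rho p d n' :
    move t n d = Some n' -> run_state P M t n' (inst rho p) ->
    run_expr M t n rho (ECall _ _ p d)
| run_all n rho x e g zs :
    (forall v, v \in sfun g M (map (value rho) zs) ->
       run_expr M t n ((x, v) :: rho) e) ->
    run_expr M t n rho (EAll x e g zs)
| run_any n rho x e g zs v :
    v \in sfun g M (map (value rho) zs) ->
    run_expr M t n ((x, v) :: rho) e ->
    run_expr M t n rho (EAny x e g zs)
| run_then n rho f zs e1 e2 :
    bfun f M (map (value rho) zs) -> run_expr M t n rho e1 ->
    run_expr M t n rho (EIf f zs e1 e2)
| run_else n rho f zs e1 e2 :
    ~~ bfun f M (map (value rho) zs) -> run_expr M t n rho e2 ->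
    run_expr M t n rho (EIf f zs e1 e2).

Definition root_node : seq nat := [::].

(** ** Well-formedness *)

Fixpoint closed_in {B S : Type} (xs : seq nat) (e : fexpr B S) : bool :=
  match e with
  | ETrue | EFalse => true
  | ETest _ zs => all (mem xs) zs
  | EAnd e1 e2 | EOr e1 e2 => closed_in xs e1 && closed_in xs e2
  | ECall p _ => all (mem xs) (pat_vars p)
  | EAll x e _ zs | EAny x e _ zs => all (mem xs) zs && closed_in (x :: xs) e
  | EIf _ zs e1 e2 => [&& all (mem xs) zs, closed_in xs e1 & closed_in xs e2]
  end.

Fixpoint moves_below {B S : Type} (k : nat) (e : fexpr B S) : bool :=
  match e with
  | ETrue | EFalse | ETest _ _ => true
  | ECall _ d => if d is Child i then i < k else true
  | EAnd e1 e2 | EOr e1 e2 | EIf _ _ e1 e2 => moves_below k e1 && moves_below k e2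
  | EAll _ e _ _ | EAny _ e _ _ => moves_below k e
  end.

(** The Boolean combination of calls left once all signature functions have been
    evaluated on [M]: either a constant, or the calls it contains. *)
Definition residue : Type := bool + seq (data * dir).

Definition res_and (x y : residue) : residue :=
  match x, y with
  | inl b, z | z, inl b => if b then z else inl false
  | inr s, inr t => inr (s ++ t)
  end.

Definition res_or (x y : residue) : residue :=
  match x, y with
  | inl b, z | z, inl b => if b then inl true else z
  | inr s, inr t => inr (s ++ t)
  end.

Fixpoint residual {L : sym_lang} {P : facet L} (M : structure L) (rho : env)
    (e : fbody P) : residue :=
  match e with
  | ETrue => inl true
  | EFalse => inl false
  | ETest f zs => inl (bfun f M (map (value rho) zs))
  | EAnd e1 e2 => res_and (residual M rho e1) (residual M rho e2)
  | EOr e1 e2 => res_or (residual M rho e1) (residual M rho e2)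
  | ECall p d => inr [:: (inst rho p, d)]
  | EAll x e g zs =>
      foldr res_and (inl true)
        [seq residual M ((x, v) :: rho) e | v <- sfun g M (map (value rho) zs)]
  | EAny x e g zs =>
      foldr res_or (inl false)
        [seq residual M ((x, v) :: rho) e | v <- sfun g M (map (value rho) zs)]
  | EIf f zs e1 e2 =>
      if bfun f M (map (value rho) zs) then residual M rho e1
      else residual M rho e2
  end.

Definition residual_calls (r : residue) : seq (data * dir) :=
  if r is inr s then s else [::].

(** [wf_used] is what it means for [asp P M] to be the states used on [M]: no
    call made from such a state leaves the set.  Without it, finiteness of
    [asp P M] would say nothing about the states a run goes through. *)
Record well_formed {L : sym_lang} (P : facet L) : Prop := WellFormed {
  wf_clause : forall M s, asp P M s -> count (state_matches s) (clauses P) = 1;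
  wf_closed : forall c p e, List.In c (clauses P) -> List.In (p, e) (cases c) ->
    closed_in (pat_vars (state_pat c) ++ pat_vars p) e;
  wf_moves : forall M s a rho e, asp P M s -> select P s a = Some (rho, e) ->
    moves_below (arity a) e;
  wf_used : forall M s a rho e, asp P M s -> select P s a = Some (rho, e) ->
    forall s' d, List.In (s', d) (residual_calls (residual M rho e)) -> asp P M s' }.

Definition computable_signature {L : sym_lang} (P : facet L) : Prop :=
  (forall f : bsym P,
     computable (fun x : structure L * seq data => bfun f x.1 x.2)) /\
  (forall g : ssym P,
     computable (fun x : structure L * seq data => sfun g x.1 x.2)).

Definition finite_asp {L : sym_lang} (P : facet L) (M : structure L) : Prop :=
  exists ss : seq data, forall s, asp P M s -> s \in ss.

(* Main.v *)
Require Import Defs.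
From HB Require Import structures.
From mathcomp Require Import all_boot.
From Stdlib Require Import Relation_Operators.
(* Again, because MathComp's [Nil] and [Cons] shadow the constructors of [prog]. *)
Import Defs.

Set Implicit Arguments.
Unset Strict Implicit.
Unset Printing Implicit Defensive.

(** Evaluating the signature functions turns the clauses into the transition
    function [delta] of an alternating two-way tree automaton whose states are
    pairs of an example structure and a Facet state, so that all examples are
    run by a single automaton; well-formedness makes its reachable states a
    finite set [Q].  A subtree acts on its surroundings only through the map
    sending the set of states accepted at its parent to the set accepted at its
    root.  These behaviours are compositional, and there are finitely many of
    them over [Q].  Hence listing trees with their behaviours by rounds of
    applying the productions reaches a round that adds no new pair of a
    nonterminal and a behaviour, after which every derivable tree behaves like
    a listed one.  [Q] and this round are found by unbounded search; everything
    else is primitive recursive. *)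

(** * Computable functions *)

(* Quantifying over [r] lets the program be reused inside any [Fix]. *)
Definition cpt {A B : Type} {eA : encoding A} {eB : encoding B} (f : A -> B) :=
  exists p : prog, forall r x, ev r p (enc x) (enc (f x)).

Ltac ev_straight :=
  repeat match goal with
  | |- ev _ (Comp _ _) _ _ => eapply ev_comp
  | |- ev _ (Cons _ _) _ _ => apply ev_cons
  | |- ev _ Id _ _ => apply ev_id
  | |- ev _ Nil _ _ => apply ev_nil
  | |- ev _ Fst _ _ => apply ev_fst
  | |- ev _ Snd _ _ => apply ev_snd
  | |- ev _ ?p _ _ => is_var p; unfold p
  end.

Section Combinators.
Context {G : Type} {eG : encoding G}.

(** Wrapping the program in [Fix] binds its [Self] to the program itself, whatever body [r]
    surrounds the call. *)
Lemma computable_cpt B {eB : encoding B} (f : G -> B) : computable f -> cpt f.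
Proof. by case=> p Hp; exists (Fix p) => r x; apply/ev_fix/Hp. Qed.

(** Programs see only codes. This allows [Some], [::], [Node] and successor to be built as pairs,
    and records to be read as tuples. *)
Lemma cpt_recode A B {eA : encoding A} {eB : encoding B} (f : G -> A) (f' : G -> B) :
  (forall x, enc (f x) = enc (f' x)) -> cpt f -> cpt f'.
Proof. by move=> E [p Hp]; exists p => r x; rewrite -E. Qed.

Lemma cpt_ext B {eB : encoding B} (f f' : G -> B) : f =1 f' -> cpt f -> cpt f'.
Proof. by move=> E; apply: cpt_recode => x; rewrite E. Qed.

Lemma cpt_id : cpt (fun g : G => g).
Proof. by exists Id => r x; constructor. Qed.

Lemma cpt_comp B C {eB : encoding B} {eC : encoding C} (f : B -> C) (g : G -> B) :
  cpt f -> cpt g -> cpt (fun x => f (g x)).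
Proof. by case=> p Hp [q Hq]; exists (Comp p q) => r x; apply: ev_comp (Hq r x) (Hp r _). Qed.

Lemma cpt_const B {eB : encoding B} (b : B) : cpt (fun _ : G => b).
Proof.
suff H d : exists p, forall r x, ev r p x d.
  by have [p Hp] := H (enc b); exists p => r x; apply: Hp.
elim: d => [|d [p Hp] d' [q Hq]]; first by exists Nil => r x; constructor.
by exists (Cons p q) => r x; constructor; [apply: Hp | apply: Hq].
Qed.

Section Pairs.
Context {A B : Type} {eA : encoding A} {eB : encoding B}.

Lemma cpt_pair (a : G -> A) (b : G -> B) : cpt a -> cpt b -> cpt (fun x => (a x, b x)).
Proof. by case=> p Hp [q Hq]; exists (Cons p q) => r x; constructor; [apply: Hp | apply: Hq]. Qed.

Lemma cpt_fst (f : G -> A * B) : cpt f -> cpt (fun x => (f x).1).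
Proof.
case=> p Hp; exists (Comp Fst p) => r x; apply: ev_comp (Hp r x) _.
by case: (f x) => a b /=; constructor.
Qed.

Lemma cpt_snd (f : G -> A * B) : cpt f -> cpt (fun x => (f x).2).
Proof.
case=> p Hp; exists (Comp Snd p) => r x; apply: ev_comp (Hp r x) _.
by case: (f x) => a b /=; constructor.
Qed.

End Pairs.
End Combinators.

Section Constructors.
Context {G A B : Type} {eG : encoding G} {eA : encoding A} {eB : encoding B}.

Lemma cpt_comp2 C {eC : encoding C} (f : A -> B -> C) (a : G -> A) (b : G -> B) :
  cpt (fun x => f x.1 x.2) -> cpt a -> cpt b -> cpt (fun x => f (a x) (b x)).
Proof. by move=> Hf Ha Hb; apply: (cpt_comp (g := fun x => (a x, b x)) Hf); apply: cpt_pair. Qed.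

Lemma cpt_if (c : G -> bool) (f f' : G -> A) :
  cpt c -> cpt f -> cpt f' -> cpt (fun x => if c x then f x else f' x).
Proof.
case=> p Hp [q Hq] [q' Hq']; exists (Cond p q q') => r x.
by have := Hp r x; case: (c x) => Hc; [apply: ev_cond_then Hc _ | apply: ev_cond_else Hc _].
Qed.

Lemma cpt_data_match (d : G -> data) (f : G -> A) (f' : G -> data -> data -> A) :
  cpt d -> cpt f -> cpt (fun x => f' x.1 x.2.1 x.2.2) ->
  cpt (fun x => match d x with Leaf => f x | Pair u v => f' x u v end).
Proof.
case=> p Hp [q Hq] [q' Hq']; exists (Cond p (Comp q' (Cons Id p)) q) => r x.
have := Hp r x; case E: (d x) => [|u v] Hc; first exact: ev_cond_else Hc _.
apply: ev_cond_then Hc _; apply: ev_comp (Hq' r (x, (u, v))).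
by apply: ev_cons; [exact: ev_id | have := Hp r x; rewrite E].
Qed.

Lemma cpt_option_match (o : G -> option A) (f : G -> A -> B) (f' : G -> B) :
  cpt o -> cpt (fun x => f x.1 x.2) -> cpt f' ->
  cpt (fun x => match o x with Some a => f x a | None => f' x end).
Proof.
case=> p Hp [q Hq] [q' Hq'].
exists (Cond p (Comp q (Cons Id (Comp Snd p))) q') => r x.
have := Hp r x; case E: (o x) => [a|] Hc; last exact: ev_cond_else Hc _.
apply: ev_cond_then Hc _; apply: ev_comp (Hq r (x, a)).
by apply: ev_cons; [exact: ev_id | apply: ev_comp (Hp r x) _; rewrite E; constructor].
Qed.

Lemma cpt_Some (a : G -> A) : cpt a -> cpt (fun x => Some (a x)).
Proof.
move=> Ha; apply: (cpt_recode (f := fun x => (Leaf, a x))) => //.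
by apply: cpt_pair => //; apply: cpt_const.
Qed.

Lemma cpt_cons (a : G -> A) (s : G -> seq A) : cpt a -> cpt s -> cpt (fun x => a x :: s x).
Proof. by move=> Ha Hs; apply: (cpt_recode (f := fun x => (a x, s x))) => //; apply: cpt_pair. Qed.

Lemma cpt_seq_match (s : G -> seq A) (f : G -> A -> seq A -> B) (f' : G -> B) :
  cpt s -> cpt (fun x => f x.1 x.2.1 x.2.2) -> cpt f' ->
  cpt (fun x => match s x with [::] => f' x | a :: s' => f x a s' end).
Proof.
case=> p Hp [q Hq] [q' Hq'].
exists (Cond p (Comp q (Cons Id p)) q') => r x.
have := Hp r x; case E: (s x) => [|a s'] Hc; first exact: ev_cond_else Hc _.
apply: ev_cond_then Hc _; apply: ev_comp (Hq r (x, (a, s'))).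
by apply: ev_cons; [exact: ev_id | have := Hp r x; rewrite E].
Qed.

Lemma cpt_foldr (s : G -> seq A) (f : G -> A -> B -> B) (z : G -> B) :
  cpt (fun x => f x.1 x.2.1 x.2.2) -> cpt z -> cpt s ->
  cpt (fun x => foldr (f x) (z x) (s x)).
Proof.
case=> p Hp [q Hq] [l Hl].
(* The loop runs on the pair of the parameter and the remaining list; [recur] passes on the
   parameter and the tail. The empty list has code [Leaf], which the test [Cond Snd] treats as
   false. *)
pose recur := Comp Self (Cons Fst (Comp Snd Snd)).
pose body := Cond Snd (Comp p (Cons Fst (Cons (Comp Fst Snd) recur))) (Comp q Fst).
exists (Comp (Fix body) (Cons Id l)) => r x.
apply: ev_comp; first by constructor; [constructor | apply: Hl].
apply: ev_fix; elim: (s x) => [|a s' IH] /=.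
  by apply: ev_cond_else; [constructor | apply: ev_comp (Hq _ _); constructor].
apply: ev_cond_then; first exact: ev_snd.
apply: ev_comp (Hp _ (x, (a, foldr (f x) (z x) s'))).
constructor; first by constructor.
constructor; first by apply: ev_comp; constructor.
apply: ev_comp; last exact: ev_self IH.
by constructor; [constructor | apply: ev_comp; constructor].
Qed.

Lemma cpt_data_eq (d d' : G -> data) : cpt d -> cpt d' -> cpt (fun x => d x == d' x).
Proof.
case=> p Hp [q Hq].
(* Both trees are traversed together: [rec1] compares the left children and [rec2] the right
   ones. *)
pose rec1 := Comp Self (Cons (Comp Fst Fst) (Comp Fst Snd)).
pose rec2 := Comp Self (Cons (Comp Snd Fst) (Comp Snd Snd)).
pose body := Cond Fst (Cond Snd (Cond rec1 rec2 Nil) Nil) (Cond Snd Nil (Cons Nil Nil)).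
exists (Comp (Fix body) (Cons p q)) => r x.
apply: ev_comp; first by constructor; [apply: Hp | apply: Hq].
apply: ev_fix; rewrite [enc _]/=; elim: (d x) (d' x) => [|u IHu v IHv] [|u' v'].
- rewrite eqxx; do 2 (apply: ev_cond_else; first by constructor).
  by constructor; constructor.
- apply: ev_cond_else; first by constructor.
  by apply: ev_cond_then; constructor.
- apply: ev_cond_then; first exact: ev_fst.
  by apply: ev_cond_else; constructor.
have -> : (Pair u v == Pair u' v') = if u == u' then v == v' else false.
  by apply/eqP/idP => [[-> ->]|]; [rewrite !eqxx | case: eqP => // -> /eqP->].
do 2 (apply: ev_cond_then; first by constructor).
have R1 : ev body rec1 (Pair (Pair u v) (Pair u' v')) (bool_code (u == u')).
  apply: ev_comp; last exact: ev_self (IHu u').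
  by constructor; apply: ev_comp; constructor.
case: (u == u') R1 => R1; last by apply: ev_cond_else R1 _; constructor.
apply: ev_cond_then R1 _; apply: ev_comp; last exact: ev_self (IHv v').
by constructor; apply: ev_comp; constructor.
Qed.

(** Unbounded search from 0 upwards. The existence hypothesis gives termination and does not enter
    the program; taking the least solution makes the value the one at which the search stops. *)
Lemma cpt_mu (t : G -> nat -> bool) (ex : forall x, exists n, t x n) :
  cpt (fun x => t x.1 x.2) -> cpt (fun x => ex_minn (ex x)).
Proof.
case=> p Hp.
pose body := Cond p Snd (Comp Self (Cons Fst (Cons Nil Snd))).
exists (Comp (Fix body) (Cons Id Nil)) => r x.
apply: ev_comp; first by constructor; constructor.
apply: ev_fix; case: ex_minnP => m tm min_m.
(* The counter increases, so the induction is on its distance [k] to the minimum. *)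
suff H : forall k n, n + k = m -> ev body body (Pair (@enc G eG x) (nat_code n)) (nat_code m).
  exact: H m 0 (add0n m).
elim=> [|k IH] n; first (rewrite addn0 => ->).
  have := Hp body (x, m); rewrite /= tm => H; exact: ev_cond_then H (ev_snd _ _ _).
move=> E; apply: ev_cond_else.
  have := Hp body (x, n); rewrite /=; case: (boolP (t x n)) => // /min_m.
  by rewrite -E addnS ltnNge leq_addr.
apply: ev_comp; last by apply: (ev_self (IH n.+1 _)); rewrite addSnnS.
by constructor; [constructor | constructor; constructor].
Qed.

End Constructors.

Fixpoint gfold {X B : Type} (base : nat -> B) (node : X -> seq B -> B) (t : gterm X) : B :=
  match t with
  | NT A => base A
  | GNode a ts => node a (map (gfold base node) ts)
  end.

Lemma cpt_gfold G X B {eG : encoding G} {eX : encoding X} {eB : encoding B}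
    (base : G -> nat -> B) (node : G -> X -> seq B -> B) (t : G -> gterm X) :
  cpt (fun x => base x.1 x.2) -> cpt (fun x => node x.1 x.2.1 x.2.2) -> cpt t ->
  cpt (fun x => gfold (base x) (node x) (t x)).
Proof.
case=> p Hp [q Hq] [l Hl].
(* [Self] reaches only the innermost [Fix], so terms and lists of terms are
   folded by one program whose argument [Pair g (Pair tag d)] says by [tag]
   whether [d] codes a list ([Leaf]) or a term. *)
pose arg := Comp Snd Snd.
pose on_list :=
  Cond arg (Cons (Comp Self (Cons Fst (Cons (Cons Nil Nil) (Comp Fst arg))))
                 (Comp Self (Cons Fst (Cons Nil (Comp Snd arg))))) Nil.
pose on_node :=
  Comp q (Cons Fst (Cons (Comp Fst (Comp Snd arg))
                         (Comp Self (Cons Fst (Cons Nil (Comp Snd (Comp Snd arg))))))).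
pose on_term := Cond (Comp Fst arg) on_node (Comp p (Cons Fst (Comp Snd arg))).
pose body := Cond (Comp Fst Snd) on_term on_list.
exists (Comp (Fix body) (Cons Id (Cons (Cons Nil Nil) l))) => r x.
apply: (@ev_comp _ _ _ _ (Pair (enc x) (Pair (Pair Leaf Leaf) (enc (t x))))).
  by ev_straight; apply: Hl.
apply: ev_fix; move: (t x); fix IH 1 => -[A|a ts].
  apply: ev_cond_then; first by ev_straight.
  apply: ev_cond_else; first by ev_straight.
  by apply: ev_comp (Hp _ (x, A)); ev_straight.
have IHs : ev body body (Pair (enc x) (Pair Leaf (list_code (map gterm_code ts))))
             (enc (map (gfold (base x) (node x)) ts)).
  elim: ts => [|u ts IHts].
    by apply: ev_cond_else; [ev_straight | apply: ev_cond_else; ev_straight].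
  apply: ev_cond_else; first by ev_straight.
  apply: ev_cond_then; first by ev_straight.
  apply: ev_cons; (apply: ev_comp; last apply: ev_self).
  - by ev_straight.
  - exact: IH.
  - by ev_straight.
  - exact: IHts.
apply: ev_cond_then; first by ev_straight.
apply: ev_cond_then; first by ev_straight.
apply: ev_comp (Hq _ (x, (a, map (gfold (base x) (node x)) ts))).
apply: ev_cons; first by ev_straight.
apply: ev_cons; first by ev_straight.
by apply: ev_comp; last exact: ev_self IHs; ev_straight.
Qed.

Ltac cpt_core :=
  match goal with
  | |- @cpt ?A ?B ?eA ?eB (@fst ?C ?D) => change (@cpt A B eA eB (fun g => g.1))
  | |- @cpt ?A ?B ?eA ?eB (@snd ?C ?D) => change (@cpt A B eA eB (fun g => g.2))
  | |- cpt (fun g => g) => apply cpt_id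
  | |- cpt (fun _ => ?c) => apply cpt_const
  | |- cpt (fun g => (_, _)) => apply cpt_pair
  | |- cpt (fun g => fst _) => apply cpt_fst
  | |- cpt (fun g => snd _) => apply cpt_snd
  | |- cpt (fun g => Some _) => apply cpt_Some
  | |- cpt (fun g => _ :: _) => apply cpt_cons
  | |- cpt (fun g => if _ then _ else _) => apply cpt_if
  | |- cpt (fun g => foldr _ _ _) => apply cpt_foldr
  | |- cpt (fun g => match _ with Some _ => _ | None => _ end) => apply cpt_option_match
  | |- cpt (fun g => match _ with nil => _ | cons _ _ => _ end) => apply cpt_seq_match
  | |- cpt (fun g => match _ with Leaf => _ | Pair _ _ => _ end) => apply cpt_data_match
  | H : cpt ?a |- cpt (fun g => ?a _) => apply (cpt_comp H)
  | H : cpt (fun x => ?f (fst x) (snd x)) |- cpt (fun g => ?f _ _) => apply (cpt_comp2 H)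
  end.

Section Booleans.
Context {G : Type} {eG : encoding G}.
Implicit Types b c : G -> bool.

Lemma cpt_andb b c : cpt b -> cpt c -> cpt (fun x => b x && c x).
Proof. by move=> Hb Hc; apply: cpt_if => //; apply: cpt_const. Qed.

Lemma cpt_orb b c : cpt b -> cpt c -> cpt (fun x => b x || c x).
Proof. by move=> Hb Hc; apply: cpt_if => //; apply: cpt_const. Qed.

Lemma cpt_eq (T : eqType) {eT : encoding T} (a b : G -> T) :
  cpt a -> cpt b -> cpt (fun x => a x == b x).
Proof.
(* Codes are compared in place of values, which is correct because encodings are injective. *)
move=> Ha Hb; apply: (@cpt_ext _ _ _ _ (fun x => enc (a x) == enc (b x))).
  by move=> x; apply: (inj_eq enc_inj).
by apply: cpt_data_eq; [apply: cpt_recode Ha | apply: cpt_recode Hb].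
Qed.

End Booleans.

Ltac cpt_base :=
  repeat (assumption || cpt_core ||
  match goal with
  | |- cpt (fun g => andb _ _) => apply cpt_andb
  | |- cpt (fun g => orb _ _) => apply cpt_orb
  | |- cpt (fun g => @eq_op ?T _ _) => apply (@cpt_eq _ _ T _)
  end).

Section Sequences.
Context {G A B : Type} {eG : encoding G} {eA : encoding A} {eB : encoding B}.

Lemma cpt_map (s : G -> seq A) (f : G -> A -> B) :
  cpt (fun x => f x.1 x.2) -> cpt s -> cpt (fun x => map (f x) (s x)).
Proof.
move=> Hf Hs; apply: (@cpt_ext _ _ _ _ (fun x => foldr (fun a r => f x a :: r) [::] (s x))).
  by move=> x; elim: (s x) => //= a r ->.
by cpt_base.
Qed.

Lemma cpt_filter (s : G -> seq A) (f : G -> A -> bool) :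
  cpt (fun x => f x.1 x.2) -> cpt s -> cpt (fun x => filter (f x) (s x)).
Proof.
move=> Hf Hs.
apply: (@cpt_ext _ _ _ _ (fun x => foldr (fun a r => if f x a then a :: r else r) [::] (s x))).
  by move=> x; elim: (s x) => //= a r ->.
by cpt_base.
Qed.

Lemma cpt_has (s : G -> seq A) (f : G -> A -> bool) :
  cpt (fun x => f x.1 x.2) -> cpt s -> cpt (fun x => has (f x) (s x)).
Proof.
move=> Hf Hs; apply: (@cpt_ext _ _ _ _ (fun x => foldr (fun a r => f x a || r) false (s x))).
  by move=> x; elim: (s x) => //= a r ->.
by cpt_base.
Qed.

Lemma cpt_all (s : G -> seq A) (f : G -> A -> bool) :
  cpt (fun x => f x.1 x.2) -> cpt s -> cpt (fun x => all (f x) (s x)).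
Proof.
move=> Hf Hs; apply: (@cpt_ext _ _ _ _ (fun x => foldr (fun a r => f x a && r) true (s x))).
  by move=> x; elim: (s x) => //= a r ->.
by cpt_base.
Qed.

Lemma cpt_cat (s t : G -> seq A) : cpt s -> cpt t -> cpt (fun x => s x ++ t x).
Proof.
move=> Hs Ht; apply: (@cpt_ext _ _ _ _ (fun x => foldr cons (t x) (s x))).
  by move=> x; elim: (s x) => //= a r ->.
by cpt_base.
Qed.

End Sequences.

Lemma cpt_flatten G A {eG : encoding G} {eA : encoding A} (s : G -> seq (seq A)) :
  cpt s -> cpt (fun x => flatten (s x)).
Proof. by move=> Hs; apply: cpt_foldr; [apply: cpt_cat | | ]; cpt_base. Qed.

Lemma cpt_mem G (T : eqType) {eG : encoding G} {eT : encoding T} (a : G -> T) (s : G -> seq T) :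
  cpt a -> cpt s -> cpt (fun x => a x \in s x).
Proof.
move=> Ha Hs; apply: (@cpt_ext _ _ _ _ (fun x => has (fun b => b == a x) (s x))).
  by move=> x; rewrite -has_pred1.
apply: cpt_has; cpt_base.
Qed.

Lemma cpt_iter G B {eG : encoding G} {eB : encoding B}
    (n : G -> nat) (f : G -> B -> B) (z : G -> B) :
  cpt n -> cpt (fun x => f x.1 x.2) -> cpt z -> cpt (fun x => iter (n x) (f x) (z x)).
Proof.
move=> Hn Hf Hz.
apply: (@cpt_ext _ _ _ _ (fun x => foldr (fun _ b => f x b) (z x) (nseq (n x) Leaf))).
  by move=> x; elim: (n x) => //= m ->.
cpt_base.
(* A number and the list of that many [Leaf] have the same code. *)
apply: (cpt_recode (f := n)) => // x.
by rewrite /= /nat_code /seq_code; elim: (n x) => //= m ->.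
Qed.

Lemma cpt_nth G A {eG : encoding G} {eA : encoding A} (a : A) (s : G -> seq A) (n : G -> nat) :
  cpt s -> cpt n -> cpt (fun x => nth a (s x) (n x)).
Proof.
move=> Hs Hn; apply: (@cpt_ext _ _ _ _ (fun x =>
    match iter (n x) (fun s' => match s' with [::] => [::] | _ :: r => r end) (s x)
    with [::] => a | b :: _ => b end)).
  move=> x; elim: (n x) (s x) => [|m IH] s'; first by case: s'.
  by rewrite iterSr IH; case: s' => //=; rewrite nth_nil.
by cpt_base; apply: cpt_iter; cpt_base.
Qed.

Ltac cpt_tac :=
  repeat (progress cpt_base ||
  match goal with
  | |- @cpt ?A ?B ?eA ?eB (map ?f) => change (@cpt A B eA eB (fun g => map f g))
  | |- cpt (fun g => map _ _) => apply cpt_map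
  | |- cpt (fun g => filter _ _) => apply cpt_filter
  | |- cpt (fun g => has _ _) => apply cpt_has
  | |- cpt (fun g => all _ _) => apply cpt_all
  | |- cpt (fun g => cat _ _) => apply cpt_cat
  | |- cpt (fun g => nth _ _ _) => apply cpt_nth
  | |- cpt (fun g => flatten _) => apply cpt_flatten
  | |- cpt (fun g => @in_mem _ _ (@mem _ (seq_predType ?T) _)) => apply (@cpt_mem _ T _ _)
  | |- cpt (fun g => iter _ _ _) => apply cpt_iter
  end).

(** * Alternating two-way tree automata *)

Definition dir_opt (d : dir) : option (option nat) :=
  match d with Up => None | Stay => Some None | Child i => Some (Some i) end.

Lemma dir_opt_inj : injective dir_opt.
Proof. by case=> [||i] [||j] //= [->]. Qed.

HB.instance Definition _ := Equality.copy dir (inj_type dir_opt_inj).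

Lemma tree_In_ind X (Pr : tree X -> Prop) :
  (forall a ts, (forall t, List.In t ts -> Pr t) -> Pr (Node a ts)) -> forall t, Pr t.
Proof.
move=> IH; fix rec 1 => -[a ts]; apply: IH.
elim: ts => [u []|t ts IHts u].
by case=> [<-|/IHts]; first exact: rec.
Qed.

Lemma onth_In X (s : seq X) i x : onth s i = Some x -> List.In x s.
Proof. by elim: s i => [|y s IH] [|i] //= => [[->]|/IH]; [left|right]. Qed.

Lemma nth_map_onth X Y (y : Y) (f : X -> Y) s i :
  nth y (map f s) i = oapp f y (onth s i).
Proof. by elim: s i => [|x s IH] [|i] //=. Qed.

Lemma subtree_rcons X (t : tree X) n i :
  subtree t (rcons n i) = obind (fun u => let: Node _ ts := u in onth ts i) (subtree t n).
Proof.
elim: n t => [|j n IH] [a ts] /=; first by case: (onth ts i).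
by case: (onth ts j).
Qed.

Lemma move_up_rcons X (t : tree X) n i : move t (rcons n i) Up = Some n.
Proof. by case: n => [|j n] //=; rewrite belast_rcons. Qed.

(** A transition is a positive formula in disjunctive normal form: [d] lists the disjuncts, each a
    list of atoms, and [o] tells which atoms hold. *)
Definition sat {X : eqType} (o : X -> Prop) (d : seq (seq X)) : Prop :=
  exists2 c, c \in d & forall x, x \in c -> o x.

Lemma sat_impl (X : eqType) (o o' : X -> Prop) d :
  (forall x, o x -> o' x) -> sat o d -> sat o' d.
Proof. by move=> H [c cd oc]; exists c => // x /oc/H. Qed.

Section Subsets.
Context {T : eqType}.

(** Subsets of [Q] are represented by filtering [Q], so that [lookup] can compare them by equality
    of lists. *)
Definition sublists (Q : seq T) : seq (seq T) :=
  foldr (fun q r => r ++ map (cons q) r) [:: [::]] Q.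

Lemma filter_sublists (p : pred T) Q : filter p Q \in sublists Q.
Proof.
elim: Q => //= q Q IH; rewrite mem_cat.
by case: (p q); [rewrite orbC map_f | rewrite IH].
Qed.

Lemma nil_sublists (Q : seq T) : [::] \in sublists Q.
Proof. by rewrite -(filter_pred0 Q) filter_sublists. Qed.

Lemma subseq_filter_sub (p p' : pred T) Q :
  subpred p p' -> subseq (filter p Q) (filter p' Q).
Proof.
move=> pp'; rewrite (_ : filter p Q = filter p (filter p' Q)) ?filter_subseq //.
rewrite -filter_predI; apply: eq_filter => q /=.
by apply/idP/andP => [pq|[]//]; split=> //; apply: pp'.
Qed.

End Subsets.

Section Automaton.
Context {A : Type} {T : eqType}.
Variable delta : T -> A -> seq (seq (T * dir)).

Definition closed_run (t : tree A) (R : seq nat -> T -> Prop) : Prop :=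
  forall n u q, subtree t n = Some u ->
    sat (fun x => exists2 n', move t n x.2 = Some n' & R n' x.1) (delta q (label u)) ->
    R n q.

(** The least closed relation, as the intersection of all closed ones. Least, because the Facet
    semantics is inductive: a run that moves around forever is not accepting. *)
Definition accepts (t : tree A) (n : seq nat) (q : T) : Prop :=
  forall R, closed_run t R -> R n q.

Lemma accepts_closed t : closed_run t (accepts t).
Proof.
move=> n u q tn S R RC; apply: (RC _ _ _ tn); apply: sat_impl S => x [n' nn' acc].
by exists n' => //; apply: acc.
Qed.

(* The behaviour of a subtree: [(U, V)] says that [V] is accepted at its root
   when [U] is what is accepted at the parent of the root. *)
Definition behaviour : Type := seq (seq T * seq T).

Definition lookup (b : behaviour) (U : seq T) : seq T :=
  foldr (fun p r => if p.1 == U then p.2 else r) [::] b.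

(** Atoms are judged locally: [U] is assumed at the parent, [X] has been reached at the node, and a
    child answers through its behaviour applied to [X], since the node is its parent. A missing
    child gets the empty table, hence accepts nothing. *)
Definition fires (U X : seq T) (bs : seq behaviour) (x : T * dir) : bool :=
  match x.2 with
  | Up => x.1 \in U
  | Stay => x.1 \in X
  | Child i => x.1 \in lookup (nth [::] bs i) X
  end.

(** The disjunct [q \in X] makes the iteration increasing by construction, without a monotonicity
    argument for [lookup]. *)
Definition grow (Q : seq T) (a : A) (bs : seq behaviour) (U X : seq T) : seq T :=
  [seq q <- Q | (q \in X) || has (all (fires U X bs)) (delta q a)].

Definition grown Q a bs U : seq T := iter (size Q) (grow Q a bs U) [::].

Definition node_behaviour (Q : seq T) (a : A) (bs : seq behaviour) : behaviour :=
  [seq (U, grown Q a bs U) | U <- sublists Q].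

Fixpoint tree_behaviour (Q : seq T) (t : tree A) : behaviour :=
  let: Node a ts := t in node_behaviour Q a (map (tree_behaviour Q) ts).

Lemma lookup_map (f : seq T -> seq T) s U :
  U \in s -> lookup [seq (V, f V) | V <- s] U = f U.
Proof. by elim: s => //= V s IH; rewrite inE eq_sym; case: eqP => [->|_ /IH]. Qed.

Section Grow.
Variables (Q : seq T) (a : A) (bs : seq behaviour) (U : seq T).
Let X k := iter k (grow Q a bs U) [::].

Lemma iter_grow_filter k : exists p : pred T, X k = filter p Q.
Proof.
by case: k => [|k]; [exists pred0; rewrite filter_pred0 | rewrite /X iterS; eexists].
Qed.

Lemma iter_grow_sublists k : X k \in sublists Q.
Proof. by have [p ->] := iter_grow_filter k; apply: filter_sublists. Qed.

Lemma iter_grow_subseq k : subseq (X k) (X k.+1).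
Proof.
have [p Ek] := iter_grow_filter k.
have -> : X k = filter [in X k] Q.
  by rewrite Ek; apply: eq_in_filter => q qQ /=; rewrite mem_filter qQ andbT.
by rewrite /X iterS -/(X k); apply: subseq_filter_sub => q /= ->.
Qed.

(** Each round adds an element until the chain is stationary, and no round exceeds [size Q]
    elements, so [size Q] rounds reach the fixed point. *)
Lemma grown_fix : grow Q a bs U (grown Q a bs U) = grown Q a bs U.
Proof.
have H k : X k.+1 = X k \/ k <= size (X k).
  elim: k => [|k [E|le]]; [by right | left | ].
    by rewrite {1}/X iterS -/(X k.+1) {1}E.
  have := size_subseq_leqif (iter_grow_subseq k) => -[le' eq'].
  have [E|] := eqVneq (X k) (X k.+1); first by left; rewrite {1}/X iterS -/(X k.+1) -E.
  move=> ne; right; apply: leq_ltn_trans le _.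
  by rewrite ltn_neqAle le' eq' ne.
have [//|le] := H (size Q); have le2 := size_subseq (iter_grow_subseq (size Q)).
have := size_subseq_leqif (iter_grow_subseq (size Q)) => -[_].
move=> E; apply/esym/eqP; rewrite -E eqn_leq le2 /=; apply: leq_trans le.
by rewrite size_filter count_size.
Qed.

End Grow.

Lemma lookup_node Q a bs U : U \in sublists Q ->
  lookup (node_behaviour Q a bs) U = grown Q a bs U.
Proof. exact: lookup_map. Qed.

Lemma lookup_tree_sublists Q t U : U \in sublists Q ->
  lookup (tree_behaviour Q t) U \in sublists Q.
Proof. by case: t => a ts UQ /=; rewrite lookup_node //; apply: iter_grow_sublists. Qed.

(** Induction on the subtree and, inside it, on the rounds of [grow]. A child is consulted with the
    set [X] of an earlier round, whose states are already known to be accepted at the node, so the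
    hypothesis on the child applies. *)
Lemma behaviour_sound Q t u n U : subtree t n = Some u -> U \in sublists Q ->
  (forall q, q \in U -> exists2 n', move t n Up = Some n' & accepts t n' q) ->
  forall q, q \in lookup (tree_behaviour Q u) U -> accepts t n q.
Proof.
elim/tree_In_ind: u n U => a ts IH n U tn UQ Uacc /=; rewrite lookup_node // /grown.
elim: (size Q) => [|k IHk] q; first by rewrite in_nil.
rewrite iterS; set X := iter k _ _ in IHk *.
rewrite mem_filter => /andP[/orP[/IHk//|/hasP[c cd /allP fc]] _].
apply: (accepts_closed tn); exists c => // -[q' d] /fc /=; case: d => [||i] /=.
- exact: Uacc.
- by move/IHk; exists n.
rewrite /fires /= nth_map_onth subtree_rcons tn /=.
case E: (onth ts i) => [v|] //= q'v; exists (rcons n i) => //.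
have tni : subtree t (rcons n i) = Some v by rewrite subtree_rcons tn.
apply: (IH _ (onth_In E) _ _ tni _ _ _ q'v); first exact: iter_grow_sublists.
by move=> p /IHk pacc; exists n => //; apply: move_up_rcons.
Qed.

(** Applying behaviours downwards from the root assigns to every node its candidate set of accepted
    states. *)
Fixpoint at_path (Q : seq T) (t : tree A) (U : seq T) (n : seq nat) : seq T :=
  let V := lookup (tree_behaviour Q t) U in
  if n is i :: n' then
    let: Node _ ts := t in oapp (fun v => at_path Q v V n') [::] (onth ts i)
  else V.

Lemma at_path_rcons Q t U n i v : subtree t (rcons n i) = Some v ->
  at_path Q t U (rcons n i) = lookup (tree_behaviour Q v) (at_path Q t U n).
Proof.
elim: n t U => [|j n IH] [a ts] U /=; first by case: (onth ts i) => //= ? [->].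
by case: (onth ts j) => //= w; apply: IH.
Qed.

Lemma at_path_sublists Q t U n u : subtree t n = Some u -> U \in sublists Q ->
  at_path Q t U n \in sublists Q.
Proof.
elim/last_ind: n u => [|n i IH] u tn UQ.
  by case: t {tn} => a ts; apply: lookup_tree_sublists.
rewrite (at_path_rcons _ _ tn); apply: lookup_tree_sublists.
by move: tn; rewrite subtree_rcons; case E: (subtree t n) => [w|] // _; apply: IH E UQ.
Qed.

Definition call_closed (Q : seq T) : Prop :=
  forall q a c x, q \in Q -> c \in delta q a -> x \in c -> x.1 \in Q.

(** The sets given by [at_path] form a closed run on the states of [Q], and [accepts] lies below
    every closed run. *)
Lemma behaviour_complete Q t q : call_closed Q -> q \in Q ->
  accepts t [::] q -> q \in lookup (tree_behaviour Q t) [::].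
Proof.
move=> QC qQ acc.
suff C : closed_run t (fun n q => q \in Q -> q \in at_path Q t [::] n).
  by have := acc _ C qQ; case: (t).
move=> n [a ts] p tn [c cd oc] pQ.
(* [U] is the set at the parent. At the root it is empty, which is harmless because [Up] leads
   nowhere from there. *)
have [U EU Uup] : exists2 U, at_path Q t [::] n = grown Q a (map (tree_behaviour Q) ts) U &
    forall n', move t n Up = Some n' -> U = at_path Q t [::] n'.
  elim/last_ind: n tn {oc} => [|n i _] tn.
    exists [::] => //; case: tn => ->.
    by apply: lookup_node; apply: nil_sublists.
  exists (at_path Q t [::] n); last by move=> n'; rewrite move_up_rcons => -[->].
  rewrite (at_path_rcons _ _ tn); apply: lookup_node.
  move: tn; rewrite subtree_rcons; case E: (subtree t n) => [w|] // _.
  exact: at_path_sublists E (nil_sublists _).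
(* By the fixed point property it is enough that one more round would add [p]. *)
rewrite EU -grown_fix mem_filter pQ andbT; apply/orP; right.
apply/hasP; exists c => //; apply/allP => -[q' d] q'c.
have q'Q : q' \in Q := QC _ _ _ _ pQ cd q'c.
have [n' /= mv /(_ q'Q)] := oc _ q'c.
rewrite /fires /=; case: d mv {q'c} => [/Uup<-//||i] /=; first by case=> <-; rewrite EU.
rewrite nth_map_onth; case E: (subtree t (rcons n i)) => [v|] // -[<-].
rewrite (at_path_rcons _ _ E) EU; move: E; rewrite subtree_rcons tn /= => -> //.
Qed.

Lemma behaviourP Q t q : call_closed Q -> q \in Q ->
  q \in lookup (tree_behaviour Q t) [::] <-> accepts t [::] q.
Proof.
move=> QC qQ; split; last exact: behaviour_complete.
by apply: (@behaviour_sound Q t t [::]) => //; apply: nil_sublists.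
Qed.
End Automaton.

(** * Saturation of regular tree grammars *)

Lemma In_cons X (x y : X) s : List.In x (y :: s) <-> y = x \/ List.In x s.
Proof. by []. Qed.

Lemma In_mem (X : eqType) (x : X) s : List.In x s <-> x \in s.
Proof.
elim: s => [|y s IH]; first by split.
rewrite inE; split=> [/In_cons[->|/IH->]|/orP[/eqP->|/IH xs]]; rewrite ?eqxx ?orbT //.
  by left.
by right.
Qed.

Lemma In_map X Y (f : X -> Y) s y : List.In y (map f s) <-> exists2 x, List.In x s & y = f x.
Proof.
elim: s => [|x s IH]; first by split=> // -[].
rewrite map_cons; split=> [/In_cons[<-|/IH[z zs E]]|[z /In_cons[->|zs] E]].
- by exists x => //; left.
- by exists z => //; right.
- by rewrite E; left.
by apply/In_cons; right; apply/IH; exists z.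
Qed.

Lemma In_filter X (p : pred X) s x : List.In x (filter p s) <-> List.In x s /\ p x.
Proof.
elim: s => [|y s IH]; first by split=> // -[].
rewrite /=; case py: (p y).
  split=> [/In_cons[<-|/IH[xs px]]|[/In_cons[->|xs] px]].
  - by split=> //; left.
  - by split=> //; right.
  - by left.
  by apply/In_cons; right; apply/IH.
split=> [/IH[xs px]|[/In_cons[yx|xs] px]]; first by split=> //; right.
  by rewrite -yx py in px.
by apply/IH.
Qed.

Lemma In_all X (p : pred X) s x : all p s -> List.In x s -> p x.
Proof. by elim: s => //= y s IH /andP[py /IH H] [<-|/H]. Qed.

Lemma In_cat X (s t : seq X) x : List.In x (s ++ t) <-> List.In x s \/ List.In x t.
Proof.
elim: s => [|y s IH]; first by split=> [|[]//]; right.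
rewrite cat_cons; split=> [/In_cons[->|/IH[xs|xt]]|[/In_cons[->|xs]|xt]].
- by left; left.
- by left; right.
- by right.
- by left.
- by apply/In_cons; right; apply/IH; left.
by apply/In_cons; right; apply/IH; right.
Qed.

Lemma In_flatten X (ss : seq (seq X)) x :
  List.In x (flatten ss) <-> exists2 s, List.In s ss & List.In x s.
Proof.
elim: ss => [|s ss IH]; first by split=> // -[].
split=> [/In_cat[xs|/IH[r rs xr]]|[r /In_cons[->|rs] xr]].
- by exists s => //; left.
- by exists r => //; right.
- by apply/In_cat; left.
by apply/In_cat; right; apply/IH; exists r.
Qed.

Definition choices {X : Type} (ls : seq (seq X)) : seq (seq X) :=
  foldr (fun l r => flatten [seq [seq x :: xs | xs <- r] | x <- l]) [:: [::]] ls.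

Lemma In_choices_nil X (xs : seq X) : List.In xs (choices [::]) <-> xs = [::].
Proof. by split=> [[<-|]|->] //; left. Qed.

Lemma In_choices_cons X (xs : seq X) l ls :
  List.In xs (choices (l :: ls)) <->
  exists x ys, [/\ xs = x :: ys, List.In x l & List.In ys (choices ls)].
Proof.
rewrite /= In_flatten; split=> [[s /In_map[x xl ->] /In_map[ys ysl ->]]|[x [ys [-> xl ysl]]]].
  by exists x, ys.
by exists [seq x :: zs | zs <- choices ls]; apply/In_map; [exists x | exists ys].
Qed.

Lemma In_choices_map X Y (f : X -> Y) (F : X -> seq Y) s :
  (forall x, List.In (f x) (F x)) -> List.In (map f s) (choices (map F s)).
Proof.
move=> H; elim: s => [|x s IH]; first by left.
by apply/In_choices_cons; exists (f x), (map f s).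
Qed.

(** Each strict increase captures a new element of [undup U], so there are at most [size (undup U)]
    of them. The conclusion is a Boolean test, as [cpt_mu] requires. *)
Lemma chain_stabilizes (X : eqType) (K : nat -> seq X) (U : seq X) :
  (forall n, {subset K n <= K n.+1}) -> (forall n, {subset K n <= U}) ->
  exists n, all [in K n] (K n.+1).
Proof.
move=> incr KU; pose m n := filter [in K n] (undup U).
have mS n : subseq (m n) (m n.+1) by apply: subseq_filter_sub => x; apply: incr.
have H n : (exists n, all [in K n] (K n.+1)) \/ n <= size (m n).
  elim: n => [|n [|le]]; [by right | by left | ].
  case S: (all [in K n] (K n.+1)); [by left; exists n | right].
  apply: leq_ltn_trans le _; have [le' eq'] := size_subseq_leqif (mS n).
  rewrite ltn_neqAle le' eq' andbT; apply: contraFN S => /eqP E.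
  apply/allP => x xK; have : x \in m n by rewrite E mem_filter /= xK mem_undup; apply: KU xK.
  by rewrite mem_filter => /andP[].
have [//|] := H (size (undup U)).+1.
by rewrite ltnNge size_filter count_size.
Qed.

Lemma gterm_In_ind X (Pr : gterm X -> Prop) :
  (forall B, Pr (NT B)) ->
  (forall a gs, (forall g, List.In g gs -> Pr g) -> Pr (GNode a gs)) -> forall g, Pr g.
Proof.
move=> IH0 IH; fix rec 1 => -[B|a gs]; first exact: IH0.
apply: IH; elim: gs => [u []|g gs IHgs u].
by case/In_cons=> [<-|/IHgs]; first exact: rec.
Qed.

Section Derivations.
Context {X : Type}.
Variable G : grammar X.

(** Derivation trees replace rewriting sequences, so that inductions follow the shape of the term;
    [generatesP] relates the two. *)
Inductive derives : gterm X -> tree X -> Prop :=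
| derives_nt B g t : List.In (B, g) (productions G) -> derives g t -> derives (NT B) t
| derives_node a gs ts : derives_all gs ts -> derives (GNode a gs) (Node a ts)
with derives_all : seq (gterm X) -> seq (tree X) -> Prop :=
| derives_nil : derives_all [::] [::]
| derives_cons g gs t ts :
    derives g t -> derives_all gs ts -> derives_all (g :: gs) (t :: ts).

Scheme derives_mut := Minimality for derives Sort Prop
  with derives_all_mut := Minimality for derives_all Sort Prop.

Lemma derives_ground t : derives (ground t) t.
Proof.
elim/tree_In_ind: t => a ts IH; constructor.
elim: ts IH => [|t ts IHts] IH /=; constructor; first by apply: IH; left.
by apply: IHts => u uts; apply: IH; right.
Qed.

Lemma derives_step g g' t : step G g g' -> derives g' t -> derives g t.
Proof.
move=> st; elim: st t => {g g'} [B g Bg|a l g g' r _ IH] t; first exact: derives_nt.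
move=> D; inversion D as [|? ? ts Ds]; subst; constructor.
elim: l ts Ds {D} => [|h l IHl] ts Ds; inversion Ds; subst; constructor=> //; first exact: IH.
exact: IHl.
Qed.

Local Notation steps := (clos_refl_trans (gterm X) (step G)).

Lemma steps_in a l r g g' : steps g g' -> steps (GNode a (l ++ g :: r)) (GNode a (l ++ g' :: r)).
Proof.
elim=> [h h' st|h|h h' h'' _ IH _ IH']; [|exact: rt_refl|exact: rt_trans IH IH'].
exact/rt_step/step_in.
Qed.

Lemma steps_derives g t : derives g t -> steps g (ground t).
Proof.
(* Children are rewritten from left to right; [l] stands for those already treated. *)
apply: (@derives_mut (fun g t => steps g (ground t))
  (fun gs ts => forall a l, steps (GNode a (l ++ gs)) (GNode a (l ++ map ground ts)))).
- by move=> B h u Bh _; apply/rt_trans/rt_step/step_here.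
- by move=> a gs ts _ /(_ a [::]).
- by move=> a l; apply: rt_refl.
move=> h gs u ts _ IH _ IHs a l; apply: rt_trans (steps_in a l gs IH) _.
by rewrite /= -!cat_rcons; apply: IHs.
Qed.

Lemma generatesP t : generates G t <-> derives (NT (start G)) t.
Proof.
split; last exact: steps_derives.
suff H g g' : steps g g' -> forall t, derives g' t -> derives g t.
  by move/H; apply; apply: derives_ground.
elim=> [h h' st u|h u //|h h' h'' _ IH _ IH' u /IH' /IH //].
exact: derives_step.
Qed.

End Derivations.

Section Saturation.
Context {A : Type} {T : eqType}.
Variable delta : T -> A -> seq (seq (T * dir)).

Section Table.
Variables (Q : seq T) (G : grammar A).

Definition item : Type := nat * (tree A * @behaviour T).

(** Nonterminals are filled with listed items only. Each tree carries its behaviour, so the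
    behaviour of a new tree is computed from those of its children. *)
Definition expand (S : seq item) (g : gterm A) : seq (tree A * @behaviour T) :=
  gfold (fun B => [seq it.2 | it <- S & it.1 == B])
    (fun a ls =>
       [seq (Node a (map fst us), node_behaviour delta Q a (map snd us)) | us <- choices ls])
    g.

Definition saturate (S : seq item) : seq item :=
  S ++ flatten [seq [seq (p.1, it) | it <- expand S p.2] | p <- productions G].

(** Trees may keep appearing forever, but keys range over a finite set; stability is therefore
    tested on keys. *)
Definition key (it : item) := (it.1, it.2.2).

Definition table n := iter n saturate [::].

Definition sound (S : seq item) : Prop := forall it, List.In it S ->
  [/\ it.2.2 = tree_behaviour delta Q it.2.1, derives G (NT it.1) it.2.1 &
      it.1 \in map fst (productions G)].

Lemma expand_sound S : sound S -> forall g t b, List.In (t, b) (expand S g) ->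
  b = tree_behaviour delta Q t /\ derives G g t.
Proof.
move=> SS; elim/gterm_In_ind => [B|a gs IH] t b /In_map /=.
  by case=> -[B' [t' b']] /In_filter [/SS /= [-> D _] /eqP <-] [-> ->].
case=> us usC [-> ->].
suff [-> D] : map snd us = map (tree_behaviour delta Q) (map fst us) /\
              derives_all G gs (map fst us).
  by split=> //; constructor.
elim: gs us IH usC => [|g gs IHgs] us IH; first by move/In_choices_nil->; split=> //; constructor.
case/In_choices_cons => -[u c] [vs [-> ug /IHgs[]]].
  by move=> h hgs; apply: IH; right.
by move=> /= -> Ds; have [-> D] := IH g (or_introl erefl) _ _ ug; split=> //; constructor.
Qed.

Lemma table_sound n : sound (table n).
Proof.
elim: n => [|n IH] it //; rewrite /table iterS -/(table n) => /In_cat[/IH //|].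
case/In_flatten => s /In_map[[B g] Bg ->] /In_map[[t b] /(expand_sound IH)[-> D] ->] /=.
split=> //; first exact: derives_nt D.
have /In_mem // : List.In B (map fst (productions G)) by apply/In_map; exists (B, g).
Qed.

(** A behaviour is the table of a map from [sublists Q] to itself, and [choices] lists all such
    tables. This is the finite bound for [table_stabilizes]. *)
Lemma tree_behaviour_choices t :
  tree_behaviour delta Q t \in choices [seq [seq (U, V) | V <- sublists Q] | U <- sublists Q].
Proof.
case: t => a ts; apply/In_mem; apply: In_choices_map => U.
apply/In_map; exists (grown delta Q a (map (tree_behaviour delta Q) ts) U) => //.
by apply/In_mem/iter_grow_sublists.
Qed.

Definition stable (S : seq item) : bool := all (fun it => key it \in map key S) (saturate S).

Lemma table_stabilizes : exists n, stable (table n).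
Proof.
have [n|n k|n /allP H] := @chain_stabilizes _ (fun n => map key (table n))
  [seq (B, b) | B <- map fst (productions G),
     b <- choices [seq [seq (U, V) | V <- sublists Q] | U <- sublists Q]].
- by rewrite /table iterS map_cat => k; rewrite mem_cat => ->.
- move/In_mem/In_map => [it /table_sound[E _ Bp] ->].
  by rewrite /key E; apply: allpairs_f => //; apply: tree_behaviour_choices.
exists n; apply: sub_all (_ : all (fun it => key it \in map key (table n.+1)) _).
  by move=> it /H.
rewrite /table iterS -/(table n).
elim: (saturate _) => //= it S IH; rewrite inE eqxx /=.
by apply: sub_all IH => k kS; rewrite inE kS orbT.
Qed.

(** Induction on the derivation: the behaviour of a node depends only on its symbol and the
    behaviours of its children, so each child may be replaced by a listed tree of equal
    behaviour. *)
Lemma stable_complete S B t : stable S -> derives G (NT B) t ->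
  exists t', List.In (B, (t', tree_behaviour delta Q t)) S.
Proof.
move=> St D.
suff [t' /In_map[[B' it] /In_filter[iS /eqP /= <-] /= E]] :
    exists t', List.In (t', tree_behaviour delta Q t) (expand S (NT B)).
  by exists t'; rewrite E.
apply: (@derives_mut _ G
  (fun g t => exists t', List.In (t', tree_behaviour delta Q t) (expand S g))
  (fun gs ts => exists2 us, List.In us (choices (map (expand S) gs)) &
                  map snd us = map (tree_behaviour delta Q) ts)) D => {B t}.
- move=> B g t Bg _ [t' tg].
  have : List.In (B, (t', tree_behaviour delta Q t)) (saturate S).
    apply/In_cat; right; apply/In_flatten; eexists; first by apply/In_map; exists (B, g).
    by apply/In_map; eexists; first exact: tg.
  (* Stability exchanges the new item for a listed one with the same key, possibly with another
     tree. *)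
  move/(In_all St)/In_mem/In_map => [[B' [t'' b]] iS [-> ->]].
  exists t''; apply/In_map; exists (B', (t'', b)) => //.
  by apply/In_filter.
- move=> a gs ts _ [us usC E]; exists (Node a (map fst us)).
  by apply/In_map; exists us => //; rewrite /= E.
- by exists [::] => //; left.
move=> g gs t ts _ [t' tg] _ [us usC E].
exists ((t', tree_behaviour delta Q t) :: us); last by rewrite /= E.
by apply/In_choices_cons; do 2 eexists; split.
Qed.

End Table.
End Saturation.

(** * Computability of behaviours and of saturation *)

Lemma dir_code_inj : injective (fun d => enc (dir_opt d)).
Proof. exact: inj_comp enc_inj dir_opt_inj. Qed.
#[export] Instance enc_dir : encoding dir := Encoding dir_code_inj.

Lemma cpt_dir_match G B {eG : encoding G} {eB : encoding B}
    (d : G -> dir) (u s : G -> B) (c : G -> nat -> B) :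
  cpt d -> cpt u -> cpt s -> cpt (fun x => c x.1 x.2) ->
  cpt (fun x => match d x with Up => u x | Stay => s x | Child i => c x i end).
Proof.
move=> Hd Hu Hs Hc; apply: (@cpt_ext _ _ _ _ (fun x =>
  match dir_opt (d x) with
  | Some o => match o with Some i => c x i | None => s x end
  | None => u x end)); first by move=> x; case: (d x).
have Hd' : cpt (fun x => dir_opt (d x)) by apply: cpt_recode Hd.
by cpt_tac.
Qed.

Lemma cpt_Node G A {eG : encoding G} {eA : encoding A} (a : G -> A) (ts : G -> seq (tree A)) :
  cpt a -> cpt ts -> cpt (fun x => Node (a x) (ts x)).
Proof. by move=> Ha Hts; apply: (cpt_recode (f := fun x => (a x, ts x))) => //; cpt_tac. Qed.

Lemma cpt_choices G X {eG : encoding G} {eX : encoding X} (ls : G -> seq (seq X)) :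
  cpt ls -> cpt (fun x => choices (ls x)).
Proof. by rewrite /choices => Hls; cpt_tac. Qed.

Lemma cpt_sublists G (T : eqType) {eG : encoding G} {eT : encoding T} (Q : G -> seq T) :
  cpt Q -> cpt (fun x => sublists (Q x)).
Proof. by rewrite /sublists => HQ; cpt_tac. Qed.

Section Automaton.
Context {A : Type} {T : eqType} {eA : encoding A} {eT : encoding T}.
Variable delta : T -> A -> seq (seq (T * dir)).
Hypothesis delta_cpt : cpt (fun x => delta x.1 x.2).

Lemma cpt_lookup G {eG : encoding G} (b : G -> @behaviour T) (U : G -> seq T) :
  cpt b -> cpt U -> cpt (fun x => lookup (b x) (U x)).
Proof. by rewrite /lookup => Hb HU; cpt_tac. Qed.

Lemma cpt_grown G {eG : encoding G} (Q : G -> seq T) (a : G -> A)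
    (bs : G -> seq (@behaviour T)) (U : G -> seq T) :
  cpt Q -> cpt a -> cpt bs -> cpt U -> cpt (fun x => grown delta (Q x) (a x) (bs x) (U x)).
Proof.
move=> HQ Ha Hbs HU.
apply: (@cpt_ext _ _ _ _ (fun x =>
  foldr (fun _ X => grow delta (Q x) (a x) (bs x) (U x) X) [::] (Q x))).
  by move=> x; rewrite /grown; move: (grow _ _ _ _ _) => f; elim: (Q x) => //= q s ->.
rewrite /grow /fires; cpt_tac; apply: cpt_dir_match; cpt_tac.
by apply: cpt_lookup; cpt_tac.
Qed.

Lemma cpt_node_behaviour G {eG : encoding G}
    (Q : G -> seq T) (a : G -> A) (bs : G -> seq (@behaviour T)) :
  cpt Q -> cpt a -> cpt bs -> cpt (fun x => node_behaviour delta (Q x) (a x) (bs x)).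
Proof.
rewrite /node_behaviour => HQ Ha Hbs; cpt_tac; last exact: cpt_sublists.
by apply: cpt_grown; cpt_tac.
Qed.

Lemma cpt_saturate G {eG : encoding G} (Q : G -> seq T) (g : G -> grammar A)
    (S : G -> seq (@item A T)) :
  cpt Q -> cpt g -> cpt S -> cpt (fun x => saturate delta (Q x) (g x) (S x)).
Proof.
rewrite /saturate /expand => HQ Hg HS.
have Hp : cpt (fun x => productions (g x)).
  apply: (cpt_snd (f := fun x => (nonterminals (g x), start (g x), productions (g x)))).
  exact: cpt_recode Hg.
cpt_tac; apply: cpt_gfold; cpt_tac.
- by apply: cpt_Node; cpt_tac.
- by apply: cpt_node_behaviour; cpt_tac.
by apply: cpt_choices; cpt_tac.
Qed.

End Automaton.

(** * Deciding emptiness *)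

Section Emptiness.
Context {A : finType} {T : eqType} {E : Type}.
Context {eA : encoding A} {eT : encoding T} {eE : encoding E}.
Variable delta : T -> A -> seq (seq (T * dir)).
Variable init : E -> seq T.
Hypothesis delta_cpt : cpt (fun x => delta x.1 x.2).
Hypothesis init_cpt : cpt init.

Definition successors (q : T) : seq T :=
  flatten [seq map fst (flatten (delta q a)) | a <- enum A].

Lemma successorsP q a c x : c \in delta q a -> x \in c -> x.1 \in successors q.
Proof.
move=> cd xc; apply/flattenP; exists (map fst (flatten (delta q a))).
  by apply: map_f; rewrite mem_enum.
by apply: map_f; apply/flattenP; exists c.
Qed.

Lemma successors_inv q p : p \in successors q ->
  exists a c x, [/\ c \in delta q a, x \in c & p = x.1].
Proof.
by case/flattenP => s /mapP[a _ ->] /mapP[x /flattenP[c cd xc] ->]; exists a, c, x.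
Qed.

Definition reach (Q : seq T) : seq T := Q ++ flatten (map successors Q).

(** [I] is an invariant of the reachable states and [U] a finite bound for it. They are only
    asserted to exist: they show that the search for a closed set ends, and the set itself is
    computed from [init] and [delta]. *)
Hypothesis reach_finite : forall x, exists U : seq T, exists I : T -> Prop,
  [/\ forall q, q \in init x -> I q, forall q, I q -> q \in U &
      forall q a c y, I q -> c \in delta q a -> y \in c -> I y.1].

Lemma reach_stabilizes x :
  exists n, all [in iter n reach (init x)] (reach (iter n reach (init x))).
Proof.
have [U [I [I0 IU IS]]] := reach_finite x.
apply: (@chain_stabilizes _ (fun n => iter n reach (init x)) U) => n q.
  by rewrite iterS mem_cat => ->.
move=> qn; apply: IU; elim: n q qn => [|n IH] q; first exact: I0.
rewrite iterS mem_cat => /orP[/IH//|/flattenP[s /mapP[p /IH Ip ->]]].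
by case/successors_inv => a [c [y [cd yc ->]]]; apply: IS Ip cd yc.
Qed.

Definition states (x : E) : seq T := iter (ex_minn (reach_stabilizes x)) reach (init x).

Lemma init_states x : {subset init x <= states x}.
Proof.
rewrite /states; elim: (ex_minn _) => [|n IH] q //= qi.
by rewrite mem_cat IH.
Qed.

Lemma states_closed x : call_closed delta (states x).
Proof.
rewrite /states; case: ex_minnP => n /allP nP _ q a c y qn cd yc; apply: nP.
rewrite mem_cat; apply/orP; right; apply/flattenP.
by exists (successors q); [apply: map_f | apply: successorsP cd yc].
Qed.

Lemma states_cpt : cpt states.
Proof.
have reach_cpt : cpt reach by rewrite /reach /successors; cpt_tac.
rewrite /states; cpt_tac.
by apply: (cpt_mu (t := fun x n => all [in iter n reach (init x)] (reach (iter n reach (init x)))));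
  cpt_tac.
Qed.

Definition items (y : E * grammar A) : seq (@item A T) :=
  table delta (states y.1) y.2 (ex_minn (table_stabilizes delta (states y.1) y.2)).

Lemma items_cpt : cpt items.
Proof.
have St : cpt states := states_cpt.
rewrite /items /table; cpt_tac; last by apply: cpt_saturate; cpt_tac.
apply: (cpt_mu (t := fun y n => stable delta (states y.1) y.2 (table delta (states y.1) y.2 n))).
rewrite /stable /key /table; cpt_tac; apply: cpt_saturate; cpt_tac.
by apply: cpt_saturate; cpt_tac.
Qed.

Definition witness (y : E * grammar A) : option (tree A) :=
  if [seq it <- items y | (it.1 == start y.2) && all [in lookup it.2.2 [::]] (init y.1)]
    is it :: _ then Some it.2.1 else None.

Lemma witness_cpt : cpt witness.
Proof.
have It := items_cpt.
have Hs : cpt (fun y : E * grammar A => start y.2).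
  apply: (cpt_snd (f := fun y : E * grammar A => (nonterminals y.2, start y.2))).
  apply: (cpt_fst (f := fun y : E * grammar A => (nonterminals y.2, start y.2, productions y.2))).
  by apply: (cpt_recode (f := fun y : E * grammar A => y.2)) => //; cpt_tac.
rewrite /witness; cpt_tac.
  by apply: (cpt_comp (f := fun y : E * grammar A => start y.2) Hs); cpt_tac.
by apply: cpt_lookup; cpt_tac.
Qed.

Lemma witnessP x G :
  match witness (x, G) with
  | Some t => generates G t /\ forall q, q \in init x -> accepts delta t [::] q
  | None => ~ exists t, generates G t /\ forall q, q \in init x -> accepts delta t [::] q
  end.
Proof.
have acc t q : q \in init x ->
    q \in lookup (tree_behaviour delta (states x) t) [::] <-> accepts delta t [::] q.
  by move=> qi; apply: behaviourP; [apply: states_closed | apply: init_states].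
rewrite /witness; case F: filter => [|[B [t b]] r].
  case=> t [/generatesP D ta].
  have St : stable delta (states x) G (items (x, G)) by rewrite /items; case: ex_minnP.
  have [t' iS] := stable_complete St D.
  (* The listed representative behaves like [t], so it would pass the filter, whose result is
     empty. *)
  suff : List.In (start G, (t', tree_behaviour delta (states x) t)) [::] by [].
  rewrite -F; apply/In_filter; split=> //=; rewrite eqxx /=.
  by apply/allP => q qi; apply/acc => //; apply: ta.
have : List.In (B, (t, b)) ((B, (t, b)) :: r) by left.
rewrite -F => /In_filter[/table_sound[/= -> D _] /andP[/eqP EB /allP ta]].
split; first by apply/generatesP; rewrite -EB.
by move=> q qi; apply/acc => //; apply: ta.
Qed.

End Emptiness.

(** * From Facet programs to automata *)

Section Dnf.
Context {X : eqType}.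
Implicit Types (x y : seq (seq X)) (o : X -> Prop).

Definition dnf_and x y : seq (seq X) := [seq c ++ c' | c <- x, c' <- y].

(* A true disjunct absorbs the others, as in [res_or]: their calls need not stay
   in the set of used states. *)
Definition dnf_or x y : seq (seq X) :=
  if ([::] \in x) || ([::] \in y) then [:: [::]] else x ++ y.

Lemma sat_true o : sat o [:: [::]].
Proof. by exists [::]; rewrite ?inE. Qed.

Lemma sat_and o x y : sat o (dnf_and x y) <-> sat o x /\ sat o y.
Proof.
split=> [[_ /allpairsP[[c c'] /= [cx cy ->]] H]|[[c cx H] [c' cy H']]].
  by split; [exists c | exists c'] => // z zc; apply: H; rewrite mem_cat zc ?orbT.
exists (c ++ c'); first exact: allpairs_f.
by move=> z; rewrite mem_cat => /orP[/H|/H'].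
Qed.

Lemma sat_or o x y : sat o (dnf_or x y) <-> sat o x \/ sat o y.
Proof.
rewrite /dnf_or; case: ifP => [/orP nil|_].
  by split=> _; [case: nil => H; [left|right]; exists [::] | apply: sat_true].
split=> [[c]|[[c cx H]|[c cy H]]].
- by rewrite mem_cat => /orP[cx|cy] H; [left|right]; exists c.
- by exists c; rewrite // mem_cat cx.
by exists c; rewrite // mem_cat cy orbT.
Qed.

End Dnf.

Lemma sat_ands (X Y : eqType) (o : X -> Prop) (F : Y -> seq (seq X)) s :
  sat o (foldr dnf_and [:: [::]] (map F s)) <-> forall v, v \in s -> sat o (F v).
Proof.
elim: s => [|v s IH]; first by split=> // _; apply: sat_true.
rewrite /= sat_and IH; split=> [[Hv H] w|H].
  by rewrite inE => /orP[/eqP->|/H].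
by split=> [|w ws]; apply: H; rewrite inE ?eqxx ?ws ?orbT.
Qed.

Lemma sat_ors (X Y : eqType) (o : X -> Prop) (F : Y -> seq (seq X)) s :
  sat o (foldr dnf_or [::] (map F s)) <-> exists2 v, v \in s & sat o (F v).
Proof.
elim: s => [|v s IH]; first by split=> [[]|[]].
rewrite /= sat_or IH; split=> [[H|[w ws H]]|[w]].
- by exists v; rewrite // inE eqxx.
- by exists w; rewrite // inE ws orbT.
by rewrite inE => /orP[/eqP->|ws] H; [left | right; exists w].
Qed.

Definition dnf_of_bool {X : Type} (b : bool) : seq (seq X) := if b then [:: [::]] else [::].

Section Facet.
Context {L : sym_lang}.
Variable P : facet L.

Fixpoint dnf (M : structure L) (rho : env) (e : fbody P) : seq (seq (data * dir)) :=
  match e with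
  | ETrue => dnf_of_bool true
  | EFalse => dnf_of_bool false
  | ETest f zs => dnf_of_bool (bfun f M (map (value rho) zs))
  | EAnd e1 e2 => dnf_and (dnf M rho e1) (dnf M rho e2)
  | EOr e1 e2 => dnf_or (dnf M rho e1) (dnf M rho e2)
  | ECall p d => [:: [:: (inst rho p, d)]]
  | EAll x e g zs =>
      foldr dnf_and [:: [::]]
        [seq dnf M ((x, v) :: rho) e | v <- sfun g M (map (value rho) zs)]
  | EAny x e g zs =>
      foldr dnf_or [::]
        [seq dnf M ((x, v) :: rho) e | v <- sfun g M (map (value rho) zs)]
  | EIf f zs e1 e2 =>
      if bfun f M (map (value rho) zs) then dnf M rho e1 else dnf M rho e2
  end.

(** A constant residue has dropped its calls, so the formula must be that very constant and contain
    no atoms; otherwise every atom must be among the calls of the residue. *)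
Definition refines (r : residue) (d : seq (seq (data * dir))) : Prop :=
  match r with
  | inl b => d = dnf_of_bool b
  | inr s => forall c x, c \in d -> x \in c -> x \in s
  end.

Lemma refines_and r r' d d' :
  refines r d -> refines r' d' -> refines (res_and r r') (dnf_and d d').
Proof.
have and0 (z : seq (seq (data * dir))) : dnf_and z [::] = [::].
  by rewrite /dnf_and; elim: z.
have and1 (z : seq (seq (data * dir))) : dnf_and z [:: [::]] = z.
  by rewrite /dnf_and; elim: z => //= c z ->; rewrite cats0.
have and1l (z : seq (seq (data * dir))) : dnf_and [:: [::]] z = z.
  by rewrite /dnf_and /= cats0 map_id.
case: r r' => [[]|s] [[]|s'] /= H H'; subst=> //; rewrite ?and0 ?and1 ?and1l //.
move=> c x /allpairsP[[c1 c2] /= [c1d c2d ->]].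
by rewrite !mem_cat => /orP[/(H _ _ c1d)|/(H' _ _ c2d)] ->; rewrite ?orbT.
Qed.

Lemma refines_or r r' d d' :
  refines r d -> refines r' d' -> refines (res_or r r') (dnf_or d d').
Proof.
case: r r' => [[]|s] [[]|s'] /= H H'; subst=> //; rewrite /dnf_or ?inE ?orbT //=.
- by case: ifP => // _ c x; rewrite inE => /eqP->.
- by rewrite orbF cats0; case: ifP => // _ c x; rewrite inE => /eqP->.
case: ifP => _ c x; first by rewrite inE => /eqP->.
by rewrite !mem_cat => /orP[/H h /h|/H' h /h] ->; rewrite ?orbT.
Qed.

Lemma refines_residual M rho e : refines (residual M rho e) (dnf M rho e).
Proof.
elim: e rho => [||f zs|e1 IH1 e2 IH2|e1 IH1 e2 IH2|p d
  |x e IH g zs|x e IH g zs|f zs e1 IH1 e2 IH2] rho //=.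
- exact: refines_and.
- exact: refines_or.
- by move=> c x; rewrite !inE => /eqP->; rewrite inE.
- by elim: (sfun _ _ _) => //= v s IHs; apply: refines_and.
- by elim: (sfun _ _ _) => //= v s IHs; apply: refines_or.
by case: (bfun _ _ _).
Qed.

(** Brings [wf_used], which speaks of residual calls, to bear on the transitions of the
    automaton. *)
Lemma dnf_calls M rho e c x :
  c \in dnf M rho e -> x \in c -> List.In x (residual_calls (residual M rho e)).
Proof.
move=> cd xc; have := refines_residual M rho e; case: (residual M rho e) => [b|s] /= H.
  by move: cd xc; rewrite H; case: b {H}; rewrite // inE => /eqP->.
exact/In_mem/(H c).
Qed.

Definition call_ok (M : structure L) (t : tree (alphabet L)) (n : seq nat)
    (x : data * dir) : Prop :=
  exists2 n', move t n x.2 = Some n' & run_state P M t n' x.1.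

Lemma sat_run_expr M t n rho e : sat (call_ok M t n) (dnf M rho e) -> run_expr M t n rho e.
Proof.
elim: e rho => [||f zs|e1 IH1 e2 IH2|e1 IH1 e2 IH2|p d
  |x e IH g zs|x e IH g zs|f zs e1 IH1 e2 IH2] rho /=.
- by move=> _; apply: run_true.
- by case.
- by case E: (bfun _ _ _); [move=> _; apply: run_test | case].
- by case/sat_and=> /IH1 ? /IH2 ?; apply: run_and.
- by case/sat_or=> [/IH1|/IH2] ?; [apply: run_or_l | apply: run_or_r].
- case=> c; rewrite inE => /eqP-> /(_ _ (mem_head _ _)) [n' mv R].
  exact: run_call mv R.
- by move/sat_ands => H; apply: run_all => v /H/IH.
- by case/sat_ors => v vs /IH; apply: run_any.
case E: (bfun _ _ _) => H; first by apply: run_then => //; apply: IH1.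
by apply: run_else; [rewrite E | apply: IH2].
Qed.

Scheme run_state_mut := Minimality for run_state Sort Prop
  with run_expr_mut := Minimality for run_expr Sort Prop.

Definition fstate : Type := (structure L * data)%type.
HB.instance Definition _ :=
  Equality.copy fstate (inj_type (@enc_inj (structure L * data) enc_prod)).
#[export] Instance enc_fstate : encoding fstate := @enc_prod (structure L) data _ _.

Definition attach (M : structure L) (d : seq (seq (data * dir))) : seq (seq (fstate * dir)) :=
  [seq [seq ((M, x.1) : fstate, x.2) | x <- c] | c <- d].

Lemma sat_attach (o : fstate * dir -> Prop) M d :
  sat o (attach M d) <-> sat (fun x => o ((M, x.1) : fstate, x.2)) d.
Proof.
split=> [[_ /mapP[c cd ->] H]|[c cd H]].
  by exists c => // x xc; apply: H; apply/mapP; exists x.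
exists [seq ((M, x.1) : fstate, x.2) | x <- c]; first exact: map_f.
by move=> _ /mapP[x xc ->]; apply: H.
Qed.

Definition case_dnf (M : structure L) (cs : seq (pat * fbody P)) (a : data) (rho : env) :=
  if first_case cs a rho is Some (rho', e) then dnf M rho' e else [::].

Definition clause_dnf (M : structure L) (s a : data) (c : clause (bsym P) (ssym P)) :=
  if pmatch (state_pat c) s [::] is Some rho then case_dnf M (cases c) a rho else [::].

(** The singleton test of [select] becomes a count. The clauses can then be handled one by one and
    joined, since only a matching clause contributes; this suits recursion on the fixed clause
    list. *)
Definition delta (q : fstate) (a : alphabet L) : seq (seq (fstate * dir)) :=
  if count (state_matches q.2) (clauses P) == 1
  then attach q.1 (flatten (map (clause_dnf q.1 q.2 (enc a)) (clauses P)))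
  else [::].

Lemma deltaE M s a :
  delta (M, s) a = if select P s a is Some (rho, e) then attach M (dnf M rho e) else [::].
Proof.
rewrite /delta /select -size_filter /=.
have -> : flatten (map (clause_dnf M s (enc a)) (clauses P)) =
    flatten (map (clause_dnf M s (enc a)) (filter (state_matches s) (clauses P))).
  elim: (clauses P) => //= c cs ->; rewrite {2}/state_matches {1}/clause_dnf.
  by case E: (pmatch _ _ _) => [rho|] //=; rewrite /clause_dnf E.
case: (filter _ _) => [|c [|c' cs]] //=; rewrite cats0 /clause_dnf.
case: (pmatch _ _ _) => [rho|] //=; rewrite /case_dnf.
by case: (first_case _ _ _) => [[rho' e]|].
Qed.

(** Both sides are least: [run_state] is itself a closed run, and conversely mutual induction on
    runs shows that [accepts] is closed under the rules of the semantics. *)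
Lemma acceptsP M t n s : accepts delta t n ((M, s) : fstate) <-> run_state P M t n s.
Proof.
split=> [acc|].
  apply: (acc (fun n q => run_state P q.1 t n q.2)) => {}n u [{acc}M {}s] tn.
  rewrite deltaE; case E: (select _ _ _) => [[rho e]|]; last by case.
  by move/sat_attach => S; apply: (run_select tn E); apply: sat_run_expr.
pose ok n (x : data * dir) :=
  exists2 n', move t n x.2 = Some n' & accepts delta t n' ((M, x.1) : fstate).
apply: (@run_state_mut L P M t (fun n s => accepts delta t n ((M, s) : fstate))
  (fun n rho e => sat (ok n) (dnf M rho e))) => {n s}.
- move=> n s u rho e tn sel _ S; apply: (accepts_closed tn).
  by rewrite deltaE sel; apply/sat_attach.
- by move=> n rho; apply: sat_true.
- by move=> n rho f zs /= ->; apply: sat_true.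
- by move=> n rho e1 e2 _ S1 _ S2; apply/sat_and.
- by move=> n rho e1 e2 _ S; apply/sat_or; left.
- by move=> n rho e1 e2 _ S; apply/sat_or; right.
- move=> n rho p d n' mv _ acc; exists [:: (inst rho p, d)]; rewrite ?inE // => x.
  by rewrite inE => /eqP->; exists n'.
- by move=> n rho x e g zs _ S; apply/sat_ands.
- by move=> n rho x e g zs v vs _ S; apply/sat_ors; exists v.
- by move=> n rho f zs e1 e2 /= -> _.
by move=> n rho f zs e1 e2 /= /negbTE-> _.
Qed.

(** * Computability of the transition function *)

Section Computability.
Hypothesis Psig : computable_signature P.

Lemma cpt_dnf_and G {eG : encoding G} (x y : G -> seq (seq (data * dir))) :
  cpt x -> cpt y -> cpt (fun z => dnf_and (x z) (y z)).
Proof. by rewrite /dnf_and => Hx Hy; cpt_tac. Qed.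

Lemma cpt_dnf_or G {eG : encoding G} (x y : G -> seq (seq (data * dir))) :
  cpt x -> cpt y -> cpt (fun z => dnf_or (x z) (y z)).
Proof. by rewrite /dnf_or => Hx Hy; cpt_tac. Qed.

Lemma cpt_find_var G {eG : encoding G} (rho : G -> env) z :
  cpt rho -> cpt (fun x => find_var (rho x) z).
Proof.
move=> Hrho; apply: (@cpt_ext _ _ _ _
  (fun x => foldr (fun p r => if z == p.1 then Some p.2 else r) None (rho x))).
  by move=> x; elim: (rho x) => //= -[y v] r ->.
by cpt_tac.
Qed.

Lemma cpt_value G {eG : encoding G} (rho : G -> env) z : cpt rho -> cpt (fun x => value (rho x) z).
Proof.
move=> Hrho; rewrite /value /odflt /oapp.
by have := cpt_find_var z Hrho => H; cpt_tac.
Qed.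

Lemma cpt_values G {eG : encoding G} (rho : G -> env) zs :
  cpt rho -> cpt (fun x => map (value (rho x)) zs).
Proof.
by move=> Hrho; elim: zs => [|z zs IH] /=; cpt_tac; apply: cpt_value.
Qed.

Lemma cpt_inst G {eG : encoding G} (rho : G -> env) p : cpt rho -> cpt (fun x => inst (rho x) p).
Proof.
move=> Hrho; elim: p => [z||p IHp q IHq] /=; [exact: cpt_value | exact: cpt_const |].
by apply: (cpt_recode (f := fun x => (inst (rho x) p, inst (rho x) q))) => //; cpt_tac.
Qed.

Lemma cpt_pmatch p G {eG : encoding G} (v : G -> data) (rho : G -> env) :
  cpt v -> cpt rho -> cpt (fun x => pmatch p (v x) (rho x)).
Proof.
elim: p G eG v rho => [z||p IHp q IHq] G eG v rho Hv Hrho /=.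
- by have := cpt_find_var z Hrho => H; cpt_tac.
- by cpt_tac.
by rewrite /obind /oapp; cpt_tac; [apply: IHp | apply: IHq]; cpt_tac.
Qed.

(** The expression is fixed, so its program is assembled by induction on [e]. The context [G] is
    generalised because the body of a quantifier is evaluated in a context extended by the bound
    value. *)
Lemma cpt_dnf e G {eG : encoding G} (M : G -> structure L) (rho : G -> env) :
  cpt M -> cpt rho -> cpt (fun x => dnf (M x) (rho x) e).
Proof.
have Hb (f : bsym P) G' (eG' : encoding G') (N : G' -> structure L) (r : G' -> env) zs :
    cpt N -> cpt r -> cpt (fun x => bfun f (N x) (map (value (r x)) zs)).
  move=> HN Hr; apply: (cpt_comp2 (f := fun M vs => bfun f M vs)
    (computable_cpt (proj1 Psig f)) HN).
  exact: cpt_values.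
have Hs (g : ssym P) G' (eG' : encoding G') (N : G' -> structure L) (r : G' -> env) zs :
    cpt N -> cpt r -> cpt (fun x => sfun g (N x) (map (value (r x)) zs)).
  move=> HN Hr; apply: (cpt_comp2 (f := fun M vs => sfun g M vs)
    (computable_cpt (proj2 Psig g)) HN).
  exact: cpt_values.
elim: e G eG M rho => [||f zs|e1 IH1 e2 IH2|e1 IH1 e2 IH2|p d
  |x e IH g zs|x e IH g zs|f zs e1 IH1 e2 IH2]
  G eG M rho HM Hrho /=.
- by cpt_tac.
- by cpt_tac.
- by rewrite /dnf_of_bool; cpt_tac; apply: Hb.
- by apply: cpt_dnf_and; [apply: IH1 | apply: IH2].
- by apply: cpt_dnf_or; [apply: IH1 | apply: IH2].
- by cpt_tac; apply: cpt_inst.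
- by cpt_tac; [apply: cpt_dnf_and; cpt_tac | apply: IH; cpt_tac | apply: Hs].
- by cpt_tac; [apply: cpt_dnf_or; cpt_tac | apply: IH; cpt_tac | apply: Hs].
by cpt_tac; [apply: Hb | apply: IH1 | apply: IH2].
Qed.

Lemma cpt_clauses G {eG : encoding G} (M : G -> structure L) (s a : G -> data) cs :
  cpt M -> cpt s -> cpt a ->
  cpt (fun x => flatten (map (clause_dnf (M x) (s x) (a x)) cs)).
Proof.
move=> HM Hs Ha; elim: cs => [|c cs IH]; first exact: cpt_const.
apply: cpt_cat IH; rewrite /clause_dnf; cpt_tac; first by apply: cpt_pmatch; cpt_tac.
elim: (cases c) => [|[p e] ces IHc]; first exact: cpt_const.
apply: (@cpt_ext _ _ _ _ (fun x => match pmatch p (a x.1) x.2 with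
  | Some rho => dnf (M x.1) rho e | None => case_dnf (M x.1) ces (a x.1) x.2 end)).
  by move=> x; rewrite [in RHS]/case_dnf /=; case: (pmatch _ _ _).
by cpt_tac; [apply: cpt_pmatch | apply: cpt_dnf]; cpt_tac.
Qed.

Lemma cpt_count_matches G {eG : encoding G} (s : G -> data) cs :
  cpt s -> cpt (fun x => count (state_matches (s x)) (cs : seq (clause (bsym P) (ssym P)))).
Proof.
move=> Hs; elim: cs => [|c cs IH]; first exact: cpt_const.
apply: (@cpt_ext _ _ _ _ (fun x => match pmatch (state_pat c) (s x) [::] with
  | Some _ => (count (state_matches (s x)) cs).+1 | None => count (state_matches (s x)) cs end)).
  by move=> x; rewrite /= /state_matches; case: (pmatch _ _ _).
cpt_tac; first by apply: cpt_pmatch; cpt_tac.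
apply: (cpt_recode (f := fun x => (Leaf, count (state_matches (s x.1)) cs))) => //.
by cpt_tac; apply: (cpt_comp (f := fun x => count (state_matches (s x)) cs) IH); cpt_tac.
Qed.

Lemma delta_cpt : cpt (fun x => delta x.1 x.2).
Proof.
rewrite /delta; cpt_tac; first by apply: cpt_count_matches; cpt_tac.
have H : cpt (fun x : fstate * alphabet L =>
    flatten (map (clause_dnf x.1.1 x.1.2 (enc x.2)) (clauses P))).
  apply: cpt_clauses; cpt_tac.
  by apply: (cpt_recode (f := fun x : fstate * alphabet L => x.2)) => //; cpt_tac.
by rewrite /attach; cpt_tac.
Qed.

End Computability.
End Facet.

(** The state for [d] is a computable function of [M] and [d], since the learner has to produce the
    start states before any expression is known. *)
Theorem theorem4p3 (L : sym_lang) (P : facet L)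
    (Pwf : well_formed P)
    (Psig : computable_signature P)
    (Pfin : forall M : structure L, finite_asp P M)
    (init : structure L -> domain L -> data)
    (init_comp : computable (fun x : structure L * domain L => init x.1 x.2))
    (init_asp : forall (M : structure L) (d : domain L), asp P M (init M d))
    (init_spec : forall (M : structure L) (e : expr L) (d : domain L),
        run_state P M (sval e) root_node (init M d) <-> sem M e = d) :
  decidable_learning L.
Proof.
pose start_states (exs : seq (structure L * domain L)) : seq (@fstate L) :=
  [seq (x.1, init x.1 x.2) : fstate | x <- exs].
have start_cpt : cpt start_states.
  rewrite /start_states; cpt_tac.
  by apply: (cpt_comp2 (computable_cpt init_comp)); cpt_tac.
have fin exs : exists U : seq (@fstate L), exists I : @fstate L -> Prop,
    [/\ forall q, q \in start_states exs -> I q, forall q, I q -> q \in U &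
        forall q a c y, I q -> c \in delta P q a -> y \in c -> I y.1].
  (* [finite_asp] bounds the states on one structure; the bounds for the finitely many example
     structures are joined. *)
  have [U UP] : exists U : seq (@fstate L), forall M s,
      List.In M (map fst exs) -> asp P M s -> ((M, s) : fstate) \in U.
    elim: (map fst exs) => [|M Ms [U IH]]; first by exists [::].
    have [ss ssP] := Pfin M; exists ([seq ((M, s) : fstate) | s <- ss] ++ U) => M' s.
    case/In_cons => [<-|MM] As; rewrite mem_cat; last by rewrite IH ?orbT.
    by rewrite map_f // ssP.
  exists U, (fun q => List.In q.1 (map fst exs) /\ asp P q.1 q.2); split.
  - move=> q /In_mem/In_map[x xs ->]; split; last exact: init_asp.
    by apply/In_map; exists x.
  - by move=> [M s] [? ?]; apply: UP.
  move=> [M s] a c y [MM As]; rewrite deltaE.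
  case sel: (select P s a) => [[rho e]|] // /mapP[c' cd ->] /mapP[[s' d] xc ->]; split=> //=.
  (* A transition keeps the structure and, by [wf_used], stays in the used states. *)
  exact: wf_used Pwf _ _ _ _ _ As sel _ _ (dnf_calls cd xc).
have [p wP] := witness_cpt (delta_cpt Psig) start_cpt fin.
exists p => exs G _ GL.
have acc (e : expr L) : (forall q, q \in start_states exs -> accepts (delta P) (sval e) [::] q) <->
    forall M d, List.In (M, d) exs -> sem M e = d.
  split=> H; first move=> M d Md.
    have q0 : ((M, init M d) : fstate) \in start_states exs.
      by apply/In_mem/In_map; exists (M, d).
    by apply/init_spec/acceptsP; apply: (H _ q0).
  by move=> q /In_mem/In_map[[M d] Md ->]; apply/acceptsP/init_spec/H.
have := wP p (exs, G); have := witnessP fin exs G.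
case: (witness _ _) => [t [Gt ta]|no] ev_p.
  exists (Some (exist _ t (GL t Gt) : expr L)); split=> //.
  by split=> //; apply/acc.
exists None; split=> // -[e [Ge es]]; apply: no.
by exists (sval e); split=> //; apply/acc.
Qed.
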